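(* Let $m,k,\Delta,M$ be growing positive integer parameters (the statement is asymptotic in $m$) with $k=m^{0.05}$ and $M\geq m/10$. Let $\varepsilon>0$ with $\varepsilon\geq 1/M^{0.25}$, and let $\Delta'\geq\Delta$ with $\Delta'\leq m^{0.001}$. Let $X^{(\Delta')}_{(\omega_1,j_1)},\dots,X^{(\Delta')}_{(\omega_M,j_M)}$ be distinct $X^{(\Delta)}$-segments, and let $X=\bigcup_{i\in[M]}X^{(\Delta')}_{(\omega_i,j_i)}$, $Y=\bigcup_{i\in[M]}Y^{(\Delta')}_{(\omega_i,j_i)}$, $Z=\bigcup_{i\in[M]}Z^{(\Delta')}_{(\omega_i,j_i)}$. Let $X'=\bigcup_{i\in[M]}X'_i$ where $X'_i\subseteq X^{(\Delta')}_{(\omega_i,j_i)}$ and $|X'_i|\geq\varepsilon|X^{(\Delta')}_{(\omega_i,j_i)}|$ for each $i$. Let $F$ be any $(\Sigma\Pi)^{\Delta}\Sigma$ syntactically multilinear variable-labelled formula with $\mathrm{Vars}(F)=X'\,\dot\cup\, Y'\,\dot\cup\, Z'$, where $Y',Z'$ are arbitrary sets of variables disjoint from each other and from $X'$ (and from $X\cup Y\cup Z$), and assume $F$ has size $s\leq\exp(k^{0.1}/\Delta^2)$. For each $i\in[M]$ let $\rho_i$ be an independent random $(X^{(\Delta')}_{(\omega_i,j_i)},Y^{(\Delta')}_{(\omega_i,j_i)},Z^{(\Delta')}_{(\omega_i,j_i)})$-restriction sampled by algorithm $\mathcal{A}$, let $\rho=\rho_1\circ\cdots\circ\rho_M$,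 and let $\tilde{Y}'=\rho(X')\cap Y$, $\tilde{Z}'=\rho(X')\cap Z$. Then $$\Pr_\rho\Big[\mathrm{relrk}_{(Y'\cup\tilde{Y}',\,Z'\cup\tilde{Z}')}(F|_\rho)\geq\exp(-k^{0.1}/\Delta)\Big]\leq\Delta\exp(-k^{0.1}/\Delta).$$
   Context: Relative rank: for disjoint variable sets $A,B$ and multilinear $g\in\mathbb{F}[A\cup B]$, $M_{(A,B)}(g)$ is the $2^{|A|}\times 2^{|B|}$ matrix whose $(m_1,m_2)$ entry (for multilinear monomials $m_1$ in $A$, $m_2$ in $B$) is the coefficient of $m_1m_2$ in $g$; $\mathrm{relrk}_{(A,B)}(g)=\mathrm{rank}(M_{(A,B)}(g))/2^{(|A|+|B|)/2}$. An $(X,Y,Z)$-restriction is a map $X\to Y\cup Z\cup\{0,1\}$; $F|_\rho$ is the polynomial obtained from $F$ by substituting $\rho(x)$ for each $x\in X'$. Variable sets: $X^{(0)}=\{x_{i,j}:i\in[4],j\in[2]\}$, $Y^{(0)}=\{y_1,y_2\}$, $Z^{(0)}=\{z_1,z_2\}$; for $\Delta\ge0$, $X^{(\Delta+1)}$ is the disjoint union of copies $X^{(\Delta+1)}_{i,j}$ ($i\in[m],j\in[2]$) of $X^{(\Delta)}$, $Y^{(\Delta+1)}=\bigcup_i(Y^{(\Delta+1)}_{i,1}\cup Y^{(\Delta+1)}_{i,2}\cup\{y^{(\Delta+1)}_i\})$ with copies $Y^{(\Delta+1)}_{i,j}$ of $Y^{(\Delta)}$ and fresh $y^{(\Delta+1)}_i$,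 and similarly for $Z$. Iterating, for $\Delta'\geq\Delta$ and $\omega\in([m]\times[2])^{\Delta'-\Delta}$, $X^{(\Delta')}$ contains a copy $X^{(\Delta')}_\omega$ of $X^{(\Delta)}$ (an $X^{(\Delta)}$-clone), obtained by following the indices in $\omega$; similarly $Y^{(\Delta')}_\omega,Z^{(\Delta')}_\omega$. For $\Delta\ge1$ and $i\in[m]$, the $X^{(\Delta)}$-segment $X^{(\Delta')}_{(\omega,i)}=X^{(\Delta')}_{(\omega,(i,1))}\cup X^{(\Delta')}_{(\omega,(i,2))}$ (each half an $X^{(\Delta-1)}$-clone), and $Y^{(\Delta')}_{(\omega,i)}=Y^{(\Delta')}_{(\omega,(i,1))}\cup Y^{(\Delta')}_{(\omega,(i,2))}\cup\{y^{(\Delta')}_{(\omega,i)}\}$, similarly $Z^{(\Delta')}_{(\omega,i)}$, where $y^{(\Delta')}_{(\omega,i)}$ is the copy of $y^{(\Delta)}_i$. ABPs: $G^{(0)}$ has vertices $s_0,u_0,t_0$, disjoint length-2 paths $\pi_1,\pi_2$ from $s_0$ to $u_0$ and $\pi_3,\pi_4$ from $u_0$ to $t_0$, edges of $\pi_i$ labelled $x_{i,1},x_{i,2}$; $G^{(\Delta+1)}$ is the series composition (sink of one identified with source of next) of $H_1,\dots,H_m$, where $H_i$ is the parallel composition (sources identified, sinks identified) of copies $G_{i,1},G_{i,2}$ of $G^{(\Delta)}$ on $X^{(\Delta+1)}_{i,1},X^{(\Delta+1)}_{i,2}$; the clone $X^{(\Delta')}_\omega$ carries the corresponding copy of $G^{(\Delta)}$.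 Restrictions: $\rho^{(0)}$ maps $x_{1,1}\mapsto y_1$, $x_{2,1}\mapsto z_1$, $x_{3,1}\mapsto y_2$, $x_{4,1}\mapsto z_2$ and $x_{i,2}\mapsto1$ ($i\in[4]$); $\rho^{(\Delta)}$ for $\Delta\ge1$ is the composition of independent samples of $\mathcal{A}$ on each of its $m$ segments. Algorithm $\mathcal{A}$ on an $X^{(\Delta)}$-segment $X_{(\omega,i)}=X_1\cup X_2$ (halves $X_j$ with copies $G_j$ of $G^{(\Delta-1)}$, $Y$- and $Z$-halves $Y_j,Z_j$, extra variables $y=y^{(\Delta')}_{(\omega,i)}$, $z=z^{(\Delta')}_{(\omega,i)}$) picks one of three options, each with probability $1/3$: $E_1$: set $X_2$ to $0$ and apply an independent copy of $\rho^{(\Delta-1)}$ on $(X_1,Y_1,Z_1)$; $E_2$: symmetric with $1,2$ exchanged; $E_3$: choose $x_1\in X_1,x_2\in X_2$ independently uniformly, let $\pi_{e_j}$ be the lexicographically smallest source-sink path of $G_j$ containing the edge labelled $x_j$, set $x_1\mapsto y$, $x_2\mapsto z$, other variables on $\pi_{e_1}\cup\pi_{e_2}$ to $1$, and all other variables of the segment to $0$. Formulas: unbounded fan-in, size = number of gates; syntactically multilinear means children of each product gate have disjoint sets of occurring variables ($\mathrm{Supp}$). A variable-labelled formula has for each gate $\Phi$ a set $\mathrm{Vars}(\Phi)\supseteq\mathrm{Supp}(\Phi)$ such that children of a sum gate have the same $\mathrm{Vars}$ as the gate, and children of a product gate have pairwise disjoint $\mathrm{Vars}$ whose union is the gate's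 $\mathrm{Vars}$; $\mathrm{Vars}(F)$ is $\mathrm{Vars}$ of the output gate. A $(\Sigma\Pi)^\Delta\Sigma$ formula has a sum output gate and along every input-to-output path sum and product gates alternate, with exactly $\Delta$ product gates and the bottom gate a sum gate. *)

(* Defs.v *)
From HB Require Import structures.
From mathcomp Require Import all_boot all_order all_algebra.
From mathcomp Require Import reals exp mpoly.
From mathcomp Require classical_sets.

Set Implicit Arguments.
Unset Strict Implicit.
Unset Printing Implicit Defensive.

Import Order.TTheory GRing.Theory Num.Theory.

Local Open Scope ring_scope.

(** * Variable sets

    Indices are 0-based: [i : 'I_m] stands for i+1 in [m], and likewise for
    ['I_2] and ['I_4]. *)

Definition fst_half : 'I_2 := ord0.
Definition snd_half : 'I_2 := ord_max.

(* X^(D).  The element (i, (j, x)) of X^(D+1) is the copy of x in X_{i,j}. *)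
Fixpoint xvar (m D : nat) : finType :=
  if D is D'.+1 then ('I_m * ('I_2 * xvar m D'))%type else ('I_4 * 'I_2)%type.

(* Y^(D), and also Z^(D), which has the same shape.  In Y^(D+1), the element
   (i, Some (j, y)) is the copy of y in Y_{i,j}, and (i, None) is the fresh
   variable y_i. *)
Fixpoint yvar (m D : nat) : finType :=
  if D is D'.+1 then ('I_m * option ('I_2 * yvar m D'))%type else 'I_2.

(* The variables of an X^(D+1)-segment (without its address), and the Y-
   (or Z-) variables attached to it. *)
Definition xseg (m D : nat) : finType := ('I_2 * xvar m D)%type.
Definition yseg (m D : nat) : finType := option ('I_2 * yvar m D).

Fixpoint clone_x (m D d : nat) :
    d.-tuple ('I_m * 'I_2) -> xvar m D -> xvar m (d + D) :=
  if d is d'.+1 then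
    fun w x => ((thead w).1, ((thead w).2, clone_x [tuple of behead w] x))
  else fun _ x => x.

Fixpoint clone_y (m D d : nat) :
    d.-tuple ('I_m * 'I_2) -> yvar m D -> yvar m (d + D) :=
  if d is d'.+1 then
    fun w y => ((thead w).1, Some ((thead w).2, clone_y [tuple of behead w] y))
  else fun _ y => y.

(* The address (w, i) of an X^(D+1)-segment inside X^(d + D+1). *)
Definition segment (m d : nat) : finType :=
  (d.-tuple ('I_m * 'I_2) * 'I_m)%type.

Definition seg_x m D d (a : segment m d) (x : xseg m D) : xvar m (d + D.+1) :=
  @clone_x m D.+1 d a.1 (a.2, x).

Definition seg_y m D d (a : segment m d) (y : yseg m D) : yvar m (d + D.+1) :=
  @clone_y m D.+1 d a.1 (a.2, y).

Definition Xsegment m D d (a : segment m d) : {set xvar m (d + D.+1)} :=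
  [set seg_x a x | x : xseg m D].

Definition Ysegment m D d (a : segment m d) : {set yvar m (d + D.+1)} :=
  [set seg_y a y | y : yseg m D].

(* All the variables a formula may use: X^(L), Y^(L), Z^(L), and arbitrary
   other variables W. *)
Definition var (m L : nat) (W : finType) : finType :=
  ((xvar m L + W) + (yvar m L + yvar m L))%type.

Definition vX m L W (x : xvar m L) : var m L W := inl (inl x).
Definition vY m L W (y : yvar m L) : var m L W := inr (inl y).
Definition vZ m L W (z : yvar m L) : var m L W := inr (inr z).

(** * Algebraic branching programs

    In the graphs below distinct edges carry distinct labels, and every
    variable of E labels an edge, so edges are identified with their labels.
    A vertex is an internal vertex, the source or the sink. *)

Record abp (E : Type) := ABP {
  inner : eqType;
  tail : E -> inner + bool;
  head : E -> inner + bool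
}.

Definition source {I : Type} : I + bool := inr false.
Definition sink {I : Type} : I + bool := inr true.

(* Internal vertices: [inl tt] is u_0 and [inr i] is the midpoint of pi_i. *)
Definition base_abp : abp ('I_4 * 'I_2) :=
  let u0 := inl (inl tt) in
  let mid (i : 'I_4) := inl (inr i) in
  @ABP ('I_4 * 'I_2) (unit + 'I_4)%type
    (fun e => if e.2 == fst_half then (if (e.1 < 2)%N then source else u0)
              else mid e.1)
    (fun e => if e.2 == fst_half then mid e.1
              else (if (e.1 < 2)%N then u0 else sink)).

Definition parallel_abp E (G : abp E) : abp ('I_2 * E) :=
  let place j (v : inner G + bool) : ('I_2 * inner G) + bool :=
    match v with inl u => inl (j, u) | inr b => inr b end in
  @ABP ('I_2 * E) ('I_2 * inner G)%type
    (fun e => place e.1 (tail G e.2)) (fun e => place e.1 (head G e.2)).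

(* The k-th terminal along a series composition of m graphs, 0 <= k <= m:
   the source, then the m - 1 identified sink-source pairs, then the sink. *)
Definition junction (m : nat) (I : Type) (k : nat) :
    ('I_m.-1 + 'I_m * I) + bool :=
  if k is k'.+1 then
    if insub k' is Some o then inl (inl o) else sink
  else source.

Definition series_abp (m : nat) E (H : abp E) : abp ('I_m * E) :=
  let place (i : 'I_m) (v : inner H + bool) :=
    match v with
    | inl u => inl (inr (i, u))
    | inr b => junction m (inner H) (i + b)
    end in
  @ABP ('I_m * E) ('I_m.-1 + 'I_m * inner H)%type
    (fun e => place e.1 (tail H e.2)) (fun e => place e.1 (head H e.2)).

Fixpoint G_abp (m D : nat) : abp (xvar m D) :=
  if D is D'.+1 then series_abp m (parallel_abp (G_abp m D')) else base_abp.

Definition st_path (E : Type) (G : abp E) (p : seq E) : bool :=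
  if p is e :: q then
    [&& tail G e == source, path (fun a b => head G a == tail G b) e q
      & head G (last e q) == sink]
  else false.

(* The subscript of a variable of X^(D), outermost indices first. *)
Fixpoint subscript (m D : nat) : xvar m D -> seq nat :=
  if D is D'.+1 then
    fun x => [:: (x.1 : nat), (x.2.1 : nat) & subscript x.2.2]
  else fun x => [:: (x.1 : nat); (x.2 : nat)].

(* Edges are ordered by subscript, so that paths, as sequences of edges, are
   compared lexicographically on the sequence of all their subscripts. *)
Definition path_key m D (p : seq (xvar m D)) : seqlexi nat :=
  flatten [seq subscript x | x <- p].

Definition lexmin_path m D (x : xvar m D) : seq (xvar m D) :=
  classical_sets.xget [::] (fun p : seq (xvar m D) =>
    [/\ st_path (G_abp m D) p, x \in p
      & forall q : seq (xvar m D), st_path (G_abp m D) q -> x \in q ->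
          (path_key p <= path_key q)%O]).

(** * Random restrictions

    A random restriction is a function of uniformly distributed coins;
    independent samples are given by distinct components of the coins. *)

Variant target (Y Z : Type) := ToY of Y | ToZ of Z | ToBit of bool.
Arguments ToY {Y Z}.
Arguments ToZ {Y Z}.
Arguments ToBit {Y Z}.

Definition map_target Y Z Y' Z' (f : Y -> Y') (g : Z -> Z')
    (t : target Y Z) : target Y' Z' :=
  match t with ToY y => ToY (f y) | ToZ z => ToZ (g z) | ToBit b => ToBit b end.

(* The coins of the algorithm on an X^(D+1)-segment: the option among E_1, E_2,
   E_3, then the coins of the copy of rho^(D) used by E_1 or E_2, then the pair
   (x_1, x_2) used by E_3.  The coins of rho^(D+1) are the coins of its m
   segments. *)
Fixpoint rho_coins (m D : nat) : finType :=
  if D is D'.+1 then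
    {ffun 'I_m -> 'I_3 * rho_coins m D' * (xvar m D' * xvar m D')}
  else unit.

Definition seg_coins (m D : nat) : finType :=
  ('I_3 * rho_coins m D * (xvar m D * xvar m D))%type.

Definition rho0 (x : 'I_4 * 'I_2) : target 'I_2 'I_2 :=
  if x.2 == fst_half then
    nth (ToBit true)
      [:: ToY fst_half; ToZ fst_half; ToY snd_half; ToZ snd_half] x.1
  else ToBit true.

Definition algA m D (rho : rho_coins m D -> xvar m D ->
                           target (yvar m D) (yvar m D))
    (c : seg_coins m D) (x : xseg m D) : target (yseg m D) (yseg m D) :=
  let: (e, r, (x1, x2)) := c in
  let copy_on h := if x.1 == h then
      map_target (fun y => Some (h, y)) (fun z => Some (h, z)) (rho r x.2)
    else ToBit false in
  match val e with
  | 0%N => copy_on fst_half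
  | 1%N => copy_on snd_half
  | _ =>
      if x == (fst_half, x1) then ToY None
      else if x == (snd_half, x2) then ToZ None
      else ToBit (x.2 \in lexmin_path (if x.1 == fst_half then x1 else x2))
  end.

Fixpoint rho (m D : nat) :
    rho_coins m D -> xvar m D -> target (yvar m D) (yvar m D) :=
  if D is D'.+1 then
    fun (c : {ffun 'I_m -> seg_coins m D'}) x =>
      map_target (pair x.1) (pair x.1) (algA (@rho m D') (c x.1) x.2)
  else fun _ x => rho0 x.

(* The composition of independent samples on the segments (a i), i < M.  It is
   meant only on the union of these segments; the value 0 elsewhere is junk. *)
Definition rho_segments m D d M (a : 'I_M -> segment m d)
    (c : {ffun 'I_M -> seg_coins m D}) (x : xvar m (d + D.+1)) :
    target (yvar m (d + D.+1)) (yvar m (d + D.+1)) :=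
  if [pick p : 'I_M * xseg m D | seg_x (a p.1) p.2 == x] is Some (i, x0) then
    map_target (@seg_y m D d (a i)) (@seg_y m D d (a i))
      (algA (@rho m D) (c i) x0)
  else ToBit false.

(* rho(X') `&` Y and rho(X') `&` Z *)
Definition image_Y m L (r : xvar m L -> target (yvar m L) (yvar m L))
    (X' : {set xvar m L}) (Y : {set yvar m L}) : {set yvar m L} :=
  [set y in Y | [exists x in X', if r x is ToY y' then y' == y else false]].

Definition image_Z m L (r : xvar m L -> target (yvar m L) (yvar m L))
    (X' : {set xvar m L}) (Z : {set yvar m L}) : {set yvar m L} :=
  [set z in Z | [exists x in X', if r x is ToZ z' then z' == z else false]].

(* Probability of an event of the uniform distribution. *)
Definition prob (R : realType) (T : finType) (E : pred T) : R :=
  #|[set t | E t]|%:R / #|T|%:R.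

(** * Variable-labelled formulas

    Each gate carries the set Vars of the gate.  The edges entering a sum gate
    carry scalars. *)

Inductive formula (F : Type) (V : finType) : Type :=
| Const of {set V} & F
| Input of {set V} & V
| Sum of {set V} & seq (F * formula F V)
| Prod of {set V} & seq (formula F V).

Section Formulas.

Variables (F : fieldType) (V : finType).
Implicit Type f : formula F V.

Definition Vars f : {set V} :=
  match f with Const A _ | Input A _ | Sum A _ | Prod A _ => A end.

Fixpoint Supp f : {set V} :=
  match f with
  | Const _ _ => set0
  | Input _ v => [set v]
  | Sum _ s => \bigcup_(A <- [seq Supp c.2 | c <- s]) A
  | Prod _ s => \bigcup_(A <- [seq Supp g | g <- s]) A
  end.

(* The number of gates, input gates included. *)
Fixpoint fsize f : nat :=
  match f with
  | Const _ _ | Input _ _ => 1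
  | Sum _ s => (sumn [seq fsize c.2 | c <- s]).+1
  | Prod _ s => (sumn [seq fsize g | g <- s]).+1
  end.

Fixpoint syntactically_multilinear f : bool :=
  match f with
  | Const _ _ | Input _ _ => true
  | Sum _ s => all (fun c => syntactically_multilinear c.2) s
  | Prod _ s => pairwise (fun g h => [disjoint Supp g & Supp h]) s
                && all syntactically_multilinear s
  end.

Fixpoint variable_labelled f : bool :=
  (Supp f \subset Vars f) &&
  match f with
  | Const _ _ | Input _ _ => true
  | Sum A s => all (fun c => Vars c.2 == A) s
               && all (fun c => variable_labelled c.2) s
  | Prod A s => [&& pairwise (fun g h => [disjoint Vars g & Vars h]) s,
                    \bigcup_(B <- [seq Vars g | g <- s]) B == A
                  & all variable_labelled s]
  end.

Definition is_input f : bool :=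
  match f with Const _ _ | Input _ _ => true | _ => false end.

(* (Sigma Pi)^D Sigma *)
Fixpoint SigmaPiSigma (D : nat) f : bool :=
  if f is Sum _ s then
    if D is D'.+1 then
      all (fun c => if c.2 is Prod _ t then all (SigmaPiSigma D') t else false)
          s
    else all (fun c => is_input c.2) s
  else false.

Definition mvar (v : V) : {mpoly F[#|V|]} := 'X_(enum_rank v).

Fixpoint computed f : {mpoly F[#|V|]} :=
  match f with
  | Const _ a => a%:MP
  | Input _ v => mvar v
  | Sum _ s => \sum_(p <- [seq c.1 *: computed c.2 | c <- s]) p
  | Prod _ s => \prod_(p <- [seq computed g | g <- s]) p
  end.

Definition substitute (sigma : V -> {mpoly F[#|V|]}) (p : {mpoly F[#|V|]}) :
    {mpoly F[#|V|]} :=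
  p \mPo [tuple sigma (enum_val i) | i < #|V|].

(* The multilinear monomial with set of variables S. *)
Definition monomial (S : {set V}) : 'X_{1..#|V|} :=
  [multinom (enum_val i \in S : nat) | i < #|V|].

Definition coef_matrix (A B : {set V}) (g : {mpoly F[#|V|]}) :
    'M[F]_(#|powerset A|, #|powerset B|) :=
  \matrix_(i, j) g@_(monomial (enum_val i :|: enum_val j)).

Definition relrk (R : realType) (A B : {set V}) (g : {mpoly F[#|V|]}) : R :=
  (\rank (coef_matrix A B g))%:R / 2 `^ ((#|A| + #|B|)%:R / 2).

End Formulas.

(* F|_rho : only the variables of X' are substituted. *)
Definition restrict (F : fieldType) m L (W : finType) (X' : {set xvar m L})
    (r : xvar m L -> target (yvar m L) (yvar m L))
    (p : {mpoly F[#|var m L W|]}) : {mpoly F[#|var m L W|]} :=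
  substitute (fun v : var m L W =>
    match v with
    | inl (inl x) =>
        if x \in X' then
          match r x with
          | ToY y => mvar F (vY W y)
          | ToZ z => mvar F (vZ W z)
          | ToBit b => b%:R
          end
        else mvar F v
    | _ => mvar F v
    end) p.

(* Main.v *)
(** Fix [T] of the order of [k^0.1] and [eta = 2^-T].  By induction on the depth,
    [relrk] is at least [s^Delta * eta] with probability at most
    [Delta * s^Delta * eta]; the relative rank is subadditive, so it suffices to
    treat a product [F_1 ... F_l] of formulas on disjoint sets of variables,
    where it is at most the product of the relative ranks of the [F_j].  The only
    invariant carried along is the total density of the variables in the
    segments, which has to be at least [Q], a constant times [T^2].

    Call [F_j] heavy on a half of a segment if it holds a fraction at least
    [Q / 2m] of it.  If many segments have such a half, then with probability
    close to 1 some segment applies a copy of [rho] to that half, [F_j] has total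
    density [Q] on the subsegments of the copies of [rho], and the induction
    hypothesis applies to [F_j].  The same happens if a single [F_j] has total
    density at least 1 on the other segments.  Otherwise every [F_j] is thinly
    spread, and only option [E_3] is used: a factor with an odd number of
    surviving variables has relative rank at most [1 / sqrt 2 <= 3/4], and
    [(3/4)^#(odd factors)] is the average, over a random set [A] of factors, of
    the sign [(-1)^#(survivors in A)], whose expectation is a product over the
    segments.

    At depth 1 the factors are affine, of rank at most 2, hence of relative rank
    at most [3/4] unless exactly 0 or 2 variables survive.  Either one factor
    meets many segments, or one finds many pairs (segment, factor) in a
    triangular position and integrates them out one by one. *)

Require Import Defs.
From mathcomp Require Import all_boot all_order all_algebra.
From mathcomp Require Import reals sequences exp.
From mathcomp Require Import mpoly ring lra zify.

Set Implicit Arguments.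
Unset Strict Implicit.
Unset Printing Implicit Defensive.

Import Order.TTheory GRing.Theory Num.Theory.

Local Open Scope ring_scope.

(** * Expectations over uniform coins *)

Section Expectation.

Variable R : realType.

Definition Ex (T : finType) (f : T -> R) : R := (\sum_t f t) / #|T|%:R.

Lemma prob_Ex (T : finType) (E : pred T) : prob R E = Ex (fun t => (E t)%:R).
Proof.
rewrite /prob /Ex cardsE -sum1_card natr_sum; congr (_ / _).
rewrite big_mkcond; apply: eq_bigr => t _.
by rewrite unfold_in /=; case: (E t).
Qed.

Lemma ler_Ex (T : finType) (f g : T -> R) :
  (forall t, f t <= g t) -> Ex f <= Ex g.
Proof. by move=> fg; apply: ler_wpM2r; [rewrite invr_ge0|apply: ler_sum]. Qed.

Lemma eq_Ex (T : finType) (f g : T -> R) : f =1 g -> Ex f = Ex g.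
Proof. by move=> fg; rewrite /Ex; congr (_ / _); apply: eq_bigr. Qed.

Lemma Ex_ge0 (T : finType) (f : T -> R) : (forall t, 0 <= f t) -> 0 <= Ex f.
Proof. by move=> f0; rewrite divr_ge0// sumr_ge0. Qed.

Lemma ExD (T : finType) (f g : T -> R) :
  Ex (fun t => f t + g t) = Ex f + Ex g.
Proof. by rewrite /Ex big_split mulrDl. Qed.

Lemma ExZl (T : finType) (a : R) (f : T -> R) :
  Ex (fun t => a * f t) = a * Ex f.
Proof. by rewrite /Ex -mulr_sumr mulrA. Qed.

Lemma ExZr (T : finType) (a : R) (f : T -> R) :
  Ex (fun t => f t * a) = Ex f * a.
Proof. by rewrite mulrC -ExZl; apply: eq_Ex => t; rewrite mulrC. Qed.

Lemma Ex_sum (T : finType) (J : Type) (s : seq J) (P : pred J)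
    (f : J -> T -> R) :
  Ex (fun t => \sum_(j <- s | P j) f j t) = \sum_(j <- s | P j) Ex (f j).
Proof. by rewrite /Ex exchange_big mulr_suml. Qed.

Lemma ler_norm_Ex (T : finType) (f : T -> R) : `|Ex f| <= Ex (fun t => `|f t|).
Proof.
rewrite /Ex normrM [X in _ * X]ger0_norm ?invr_ge0//.
by apply: ler_wpM2r; [rewrite invr_ge0|apply: ler_norm_sum].
Qed.

Lemma Ex_cst (T : finType) (a : R) : (0 < #|T|)%N -> Ex (fun _ : T => a) = a.
Proof.
by move=> T0; rewrite /Ex sumr_const -[a *+ _]mulr_natr mulfK// pnatr_eq0 -lt0n.
Qed.

Lemma Ex_le_cst (T : finType) (a : R) (f : T -> R) :
  0 <= a -> (forall t, f t <= a) -> Ex f <= a.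
Proof.
move=> a0 fa; have [T0|T0] := posnP #|T|.
  by rewrite /Ex T0 invr0 mulr0.
by rewrite -(Ex_cst a T0); apply: ler_Ex.
Qed.

Lemma Ex_pair (S T : finType) (f : S * T -> R) :
  Ex f = Ex (fun s => Ex (fun t => f (s, t))).
Proof.
rewrite /Ex -mulr_suml -mulrA -invfM -natrM card_prod mulnC.
by congr (_ / _); rewrite pair_big; apply: eq_bigr => -[].
Qed.

(** Independence of the components of uniform coins. *)
Lemma Ex_prod (I C : finType) (g : I -> C -> R) :
  Ex (fun c : {ffun I -> C} => \prod_i g i (c i)) = \prod_i Ex (g i).
Proof.
rewrite /Ex -(bigA_distr_bigA g) card_ffun natrX.
by rewrite big_split /= prodr_const exprVn.
Qed.

Lemma Ex_prodM (S T : finType) (f : S -> R) (g : T -> R) :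
  Ex (fun p : S * T => f p.1 * g p.2) = Ex f * Ex g.
Proof. by rewrite Ex_pair -ExZr; apply: eq_Ex => s; rewrite -ExZl. Qed.

(* Fubini in the form used for conditioning: [op t s] replaces a part of [t],
   whose old value is [back t], by [s]. *)
Lemma Ex_resample (T S : finType) (op : T -> S -> T) (back : T -> S)
    (f : T -> R) :
  (0 < #|S|)%N ->
  (forall t s, op (op t s) (back t) = t) ->
  (forall t s, back (op t s) = s) ->
  Ex f = Ex (fun t => Ex (fun s => f (op t s))).
Proof.
move=> S0 opK backK.
rewrite -(Ex_pair (fun p => f (op p.1 p.2))) /Ex card_prod mulnC natrM invfM mulrA.
(* [h] exchanges the stored part with the sample. Being an involution it permutes [T * S], and
   reindexing by it cancels [op]. *)
congr (_ / _); pose h (p : T * S) := (op p.1 p.2, back p.1).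
have hK : involutive h by case=> t s; rewrite /h /= opK backK.
rewrite [in RHS](reindex_inj (inv_inj hK)) /=.
under [in RHS]eq_bigr do rewrite opK.
rewrite -(pair_big xpredT xpredT (fun t s => f t)) /=.
rewrite [in RHS](eq_bigr (fun t => f t * #|S|%:R)).
  by rewrite -mulr_suml -mulrA divff ?mulr1 ?pnatr_eq0 -?lt0n.
by move=> t _; rewrite sumr_const -[LHS]mulr_natr.
Qed.

Definition upd (I C : finType) (c : {ffun I -> C}) (i : I) (x : C) :
    {ffun I -> C} := [ffun i' => if i' == i then x else c i'].

Lemma Ex_upd (I C : finType) (i : I) (f : {ffun I -> C} -> R) :
  (0 < #|C|)%N -> Ex f = Ex (fun c => Ex (fun x => f (upd c i x))).
Proof.
move=> C0; apply: (Ex_resample (op := fun c x => upd c i x) (back := fun c => c i)) => // c x.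
  by apply/ffunP => j; rewrite !ffunE; case: eqP => [->|].
by rewrite ffunE eqxx.
Qed.

Lemma prob_le (T : finType) (E E' : pred T) :
  (forall t, E t -> E' t) -> prob R E <= prob R E'.
Proof.
move=> EE'; rewrite !prob_Ex; apply: ler_Ex => t; rewrite ler_nat.
by case: (E t) (EE' t) => [/(_ isT)->|].
Qed.

Lemma prob_or (T : finType) (E1 E2 : pred T) :
  prob R (fun t => E1 t || E2 t) <= prob R E1 + prob R E2.
Proof.
rewrite !prob_Ex -ExD; apply: ler_Ex => t; rewrite -natrD ler_nat.
by case: (E1 t) (E2 t) => [] [].
Qed.

Lemma prob_exists (T J : finType) (E : J -> pred T) (b : R) :
  (forall j, prob R (E j) <= b) ->
  prob R (fun t => [exists j, E j t]) <= #|J|%:R * b.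
Proof.
move=> Eb; rewrite mulr_natl -sumr_const.
apply: le_trans (ler_sum _ (fun j _ => Eb j)); under eq_bigr do rewrite prob_Ex.
rewrite -Ex_sum prob_Ex; apply: ler_Ex => t; rewrite -natr_sum ler_nat.
by case: existsP => // -[j Ej]; rewrite (bigD1 j)//= Ej.
Qed.

Lemma markov (T : finType) (a : R) (E : pred T) (f : T -> R) :
  0 < a -> (forall t, 0 <= f t) -> (forall t, E t -> a <= f t) ->
  prob R E <= Ex f / a.
Proof.
move=> a0 f0 Ef; rewrite prob_Ex -ExZr; apply: ler_Ex => t.
case: (E t) (Ef t) => [/(_ isT) aft|_]; first by rewrite ler_pdivlMr ?mul1r.
exact: divr_ge0 (f0 t) (ltW a0).
Qed.

End Expectation.

(** * Surviving variables of a segment *)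

Section Survivors.

Variable m : nat.

Definition is_bit Y Z (t : target Y Z) : bool :=
  if t is ToBit _ then true else false.

Definition survivors D (c : seg_coins m D) : {set xseg m D} :=
  [set x | ~~ is_bit (algA (@rho m D) c x)].

Lemma is_bit_map Y Z Y' Z' (f : Y -> Y') (g : Z -> Z') (t : target Y Z) :
  is_bit (map_target f g t) = is_bit t.
Proof. by case: t. Qed.

Definition third_option : 'I_3 := ord_max.

(** Meant for the options [E_1] and [E_2] only; the value at [E_3] is junk. *)
Definition half_of (e : 'I_3) : 'I_2 :=
  if val e == 0%N then fst_half else snd_half.

Lemma half_cases (h : 'I_2) : h = fst_half \/ h = snd_half.
Proof. by case: h => [[|[|//]] p]; [left|right]; apply: val_inj. Qed.

Lemma option_cases (e : 'I_3) : (val e < 2)%N \/ e = third_option.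
Proof. by case: e => [[|[|[|//]]] p]; [left|left|right; apply: val_inj]. Qed.

Lemma survivors_E3 D r (x1 x2 : xvar m D) :
  survivors (third_option, r, (x1, x2)) = [set (fst_half, x1); (snd_half, x2)].
Proof.
by apply/setP => x; rewrite !inE /=; case: eqP => //= _; case: eqP.
Qed.

Lemma survivors_E12 D (e : 'I_3) r (x12 : xvar m D * xvar m D) h x :
  (val e < 2)%N ->
  ((h, x) \in survivors (e, r, x12)) = (h == half_of e) && ~~ is_bit (rho r x).
Proof.
case: x12 => x1 x2; case: e => -[|[|//]] p _; rewrite inE /= /half_of /=;
  case: eqP => // _; by rewrite is_bit_map.
Qed.

Lemma survivors_E12_0 (e : 'I_3) r (x12 : xvar m 0 * xvar m 0) h x :
  (val e < 2)%N ->
  ((h, x) \in survivors (e, r, x12)) = (h == half_of e) && (x.2 == fst_half).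
Proof.
move=> e2; rewrite survivors_E12//=; congr (_ && _); rewrite /rho0.
by case: x => -[[|[|[|[|//]]]] p] y /=; case: eqP.
Qed.

(** A copy of [rho] on an active half consists of independent samples on [m] segments one level
    lower. The induction on the depth rests on this. *)
Lemma survivors_E12_S D (e : 'I_3) (r : {ffun 'I_m -> seg_coins m D})
    (x12 : xvar m D.+1 * xvar m D.+1) h l (x : xseg m D) :
  (val e < 2)%N ->
  ((h, (l, x)) \in survivors ((e, r, x12) : seg_coins m D.+1))
  = (h == half_of e) && (x \in survivors (r l)).
Proof. by move=> e2; rewrite (survivors_E12 (D := D.+1))//= is_bit_map inE. Qed.

(** Makes the renaming of survivors by their targets injective, so that counting survivors counts
    the variables left after the restriction. *)
Definition injective_on_survivors A Y Z (f : A -> target Y Z) : Prop :=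
  forall x x', ~~ is_bit (f x) -> f x = f x' -> x = x'.

Lemma map_target_inj Y Z Y' Z' (f : Y -> Y') (g : Z -> Z') (t t' : target Y Z) :
  injective f -> injective g -> ~~ is_bit t ->
  map_target f g t = map_target f g t' -> t = t'.
Proof. by move=> fi gi; case: t t' => [y|z|b] [y'|z'|b'] //= _ [] => [/fi|/gi] ->. Qed.

(** [E_1] and [E_2] tag the targets of [rho] with the half and keep its injectivity; under [E_3] one
    survivor goes to [y] and the other to [z]. *)
Lemma algA_inj D (c : seg_coins m D) :
  (forall r, injective_on_survivors (@rho m D r)) ->
  injective_on_survivors (algA (@rho m D) c).
Proof.
move=> rho_inj; case: c => -[e r] [x1 x2] [h x] [h' x'] /=.
have pinj k T : injective (fun t : T => Some (k : 'I_2, t)) by move=> ? ? [].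
have copy k : ~~ is_bit (if h == k
      then map_target (fun y => Some (k, y)) (fun z => Some (k, z)) (rho r x)
      else ToBit false) ->
    (if h == k
      then map_target (fun y => Some (k, y)) (fun z => Some (k, z)) (rho r x)
      else ToBit false) =
    (if h' == k
      then map_target (fun y => Some (k, y)) (fun z => Some (k, z)) (rho r x')
      else ToBit false) -> (h, x) = (h', x').
  case: eqP => [->|//]; case: eqP => [->|_]; last by case: (rho r x).
  rewrite is_bit_map => bx /map_target_inj-/(_ (pinj _ _) (pinj _ _) bx).
  by move=> /rho_inj-/(_ bx) ->.
case: (val e) => [|[|_]]; [exact: copy|exact: copy|].
case: eqP => [[-> ->]|_].
  by case: eqP => [[-> ->]//|_]; case: eqP.
case: eqP => [[-> ->] _|//].
by case: eqP => // _; case: eqP => [[-> ->]|].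
Qed.

Lemma rho_inj D (r : rho_coins m D) : injective_on_survivors (@rho m D r).
Proof.
elim: D r => [|D IH] r.
  case=> i j [i' j']; rewrite /= /rho0 /=.
  case: (half_cases j) => ->; case: (half_cases j') => -> /=; rewrite ?eqxx //=;
  case: i => -[|[|[|[|//]]]] p; case: i' => -[|[|[|[|//]]]] p' //= _ _;
  by congr (_, _); apply: val_inj.
move=> [i x] [i' x'] /=; rewrite is_bit_map => bx E.
have ii' : i = i' by move: bx E; case: (algA _ _ x) (algA _ _ x') =>
  [y|z|b] [y'|z'|b'] //= _ [].
subst i'; congr (_, _); apply: (algA_inj IH bx).
by apply: map_target_inj bx E => ? ? [].
Qed.

Lemma xvar_gt0 D : (0 < m)%N -> (0 < #|xvar m D|)%N.
Proof.
move=> m0; elim: D => [|D IH]; first by rewrite card_prod !card_ord.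
by rewrite /= !card_prod !card_ord !muln_gt0 m0.
Qed.

Lemma seg_coins_gt0 D : (0 < m)%N -> (0 < #|seg_coins m D|)%N.
Proof.
move=> m0; have X0 D' := xvar_gt0 D' m0.
have coins D' : (0 < #|rho_coins m D'|)%N -> (0 < #|seg_coins m D'|)%N.
  by move=> r0; rewrite !card_prod card_ord !muln_gt0 r0 X0.
by elim: D => [|D IH]; apply: coins; rewrite ?card_unit //= card_ffun expn_gt0 IH.
Qed.

End Survivors.

(** * Sign of the number of survivors in one segment *)

Section ParityOfOneSegment.

Variables (R : realType) (m D : nat).
Hypothesis m_gt0 : (0 < m)%N.

Local Notation N := #|xvar m D|.

Definition half_section (U : {set xseg m D}) (h : 'I_2) : {set xvar m D} :=
  [set x | (h, x) \in U].

Lemma card_half_section (U : {set xseg m D}) :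
  (#|half_section U fst_half| + #|half_section U snd_half| = #|U|)%N.
Proof.
rewrite -[RHS]sum1_card (eq_bigl (fun p : xseg m D => (p.1, p.2) \in U)); last by case.
rewrite -(pair_big_dep xpredT (fun h x => (h, x) \in U) (fun _ _ => 1%N)) /=.
rewrite big_ord_recl big_ord1; congr (_ + _)%N; rewrite -sum1_card;
by apply: eq_bigl => x; rewrite inE //; congr ((_, _) \in U); apply: val_inj.
Qed.

Lemma Ex_sign (T : finType) (A : {set T}) : (0 < #|T|)%N ->
  Ex (fun x => (-1) ^+ (x \in A) : R) = 1 - 2 * (#|A|%:R / #|T|%:R).
Proof.
move=> T0; have T0' : #|T|%:R != 0 :> R by rewrite pnatr_eq0 -lt0n.
rewrite (eq_Ex (g := fun x => 1 + (-2) * (x \in A)%:R)); last first.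
  by move=> x; case: (x \in A) => /=; ring.
by rewrite ExD ExZl Ex_cst// -prob_Ex /prob cardsE; ring.
Qed.

Lemma card_survivors_E3 (U : {set xseg m D}) r x1 x2 :
  #|survivors (third_option, r, (x1, x2)) :&: U|
  = (((fst_half, x1) \in U) + ((snd_half, x2) \in U))%N.
Proof.
rewrite survivors_E3 setIUl cardsU.
have sing (x : xseg m D) : #|[set x] :&: U| = (x \in U).
  have [xU|xU] := boolP (x \in U).
    by rewrite (setIidPl _) ?sub1set// cards1.
  by apply/eqP; rewrite cards_eq0 setI_eq0 disjoints1.
rewrite !sing setIACA setIid.
have -> : [set (fst_half, x1)] :&: [set (snd_half, x2)] = set0 :> {set xseg m D}.
  by apply/setP => x; rewrite !inE; case: eqP => // ->.
by rewrite set0I cards0 subn0.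
Qed.

(** Options [E_1] and [E_2] contribute at most 1. Under [E_3], of probability 1/3, the two edges are
    independent and the sign has expectation [(1 - 2 * a) * (1 - 2 * b)], with [a] and [b] the
    densities of [U] in the halves. As both are at most 1/2, this lies between 0 and
    [1 - (a + b)]. *)
Lemma Ex_sign_survivors (U : {set xseg m D}) :
  (forall h, 2 * #|half_section U h| <= N)%N ->
  `|Ex (fun c : seg_coins m D => (-1) ^+ #|survivors c :&: U|)|
    <= 1 - #|U|%:R / (3 * N%:R) :> R.
Proof.
move=> U_half; have N0 : 0 < N%:R :> R by rewrite ltr0n xvar_gt0.
pose dens h : R := #|half_section U h|%:R / N%:R.
pose a := dens fst_half; pose b := dens snd_half.
have dens_ge0 h : 0 <= dens h by apply: divr_ge0.
have dens_le h : dens h <= 1 / 2.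
  rewrite ler_pdivrMr//; have := U_half h; rewrite -(ler_nat R) natrM; lra.
have [a0 a2] := (dens_ge0 fst_half : 0 <= a, dens_le fst_half : a <= 1 / 2).
have [b0 b2] := (dens_ge0 snd_half : 0 <= b, dens_le snd_half : b <= 1 / 2).
have E3 r : Ex (fun x12 : xvar m D * xvar m D =>
    (-1) ^+ #|survivors (third_option, r, x12) :&: U|)
    = (1 - 2 * a) * (1 - 2 * b) :> R.
  rewrite -!Ex_sign ?xvar_gt0// -Ex_prodM; apply: eq_Ex => -[x1 x2].
  by rewrite card_survivors_E3 exprD !inE.
rewrite Ex_pair; apply: (le_trans (ler_norm_Ex _)).
pose bd (e : 'I_3) : R := if e == third_option then 1 - (a + b) else 1.
apply: (@le_trans _ _ (Ex (fun er : 'I_3 * rho_coins m D => bd er.1))).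
  apply: ler_Ex => -[e r] /=; rewrite /bd; case: eqP => [->|_].
    rewrite E3 ger0_norm; first by nra.
    by apply: mulr_ge0; lra.
  apply: (le_trans (ler_norm_Ex _)); apply: Ex_le_cst => // x12.
  by rewrite normrX normrN1 expr1n.
rewrite Ex_pair; apply: (@le_trans _ _ (Ex bd)).
  apply: ler_Ex => e /=; apply: Ex_le_cst => //.
  by rewrite /bd; case: eqP => _; lra.
rewrite /Ex card_ord !big_ord_recl big_ord0 /bd.
have [-> -> ->] : [/\ (ord0 == third_option) = false,
    (lift ord0 ord0 == third_option) = false
    & (lift ord0 (lift ord0 ord0) == third_option) = true] by [].
have -> : #|U|%:R / (3 * N%:R) = (a + b) / 3 :> R.
  by rewrite -card_half_section natrD invfM mulrCA -mulrDl mulrC.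
lra.
Qed.

End ParityOfOneSegment.

(** * Parities of the numbers of survivors *)

Section RandomSubset.

Variables (R : realType) (J : finType).

(* The probability of [A] when each element of [J] is kept with probability
   1/8. *)
Definition subset_weight (A : {set J}) : R :=
  \prod_j (if j \in A then 1 / 8 else 7 / 8).

Lemma subset_weight_ge0 A : 0 <= subset_weight A.
Proof. by apply: prodr_ge0 => j _; case: ifP => _; rewrite divr_ge0. Qed.

Lemma sum_subset_weight (y : J -> R) :
  \sum_(A in {set J}) subset_weight A * \prod_j (if j \in A then y j else 1)
  = \prod_j (1 / 8 * y j + 7 / 8).
Proof.
rewrite bigA_distr; apply: eq_bigr => A _; rewrite -big_split /=.
by apply: eq_bigr => j _; case: ifP; rewrite ?mulr1.
Qed.

Lemma prod_if_in (A : {set J}) (y : J -> R) :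
  \prod_j (if j \in A then y j else 1) = \prod_(j in A) y j.
Proof. by rewrite [RHS]big_mkcond. Qed.

Lemma card_bigcup_disjoint (T : finType) (P : pred J) (F : J -> {set T}) :
  (forall j j', j != j' -> [disjoint F j & F j']) ->
  (#|\bigcup_(j | P j) F j| = \sum_(j | P j) #|F j|)%N.
Proof.
move=> Fdis; pose F' j := if P j then F j else set0.
rewrite big_mkcond [RHS]big_mkcond /= -sum1_card.
rewrite (@partition_disjoint_bigcup _ _ _ _ _ F') => [|j j' jj'].
  by apply: eq_bigr => j _; rewrite sum1_card /F'; case: ifP; rewrite ?cards0.
rewrite /F'; case: ifP => _; last by rewrite -setI_eq0 set0I.
by case: ifP => _; [exact: Fdis|rewrite -setI_eq0 setI0].
Qed.

End RandomSubset.

(** * Elementary bounds on the exponential *)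

Section ExpBounds.

Variable R : realType.
Implicit Type x : R.

Lemma expRN_le x : 0 <= x <= 1 -> expR (- x) <= 1 - x / 2.
Proof.
move=> /andP[x0 x1]; rewrite expRN -[leLHS]mul1r ler_pdivrMr ?expR_gt0//.
have := expR_ge1Dx x; nra.
Qed.

Lemma expR_le x : 0 <= x <= 1 / 2 -> expR x <= 1 + 2 * x.
Proof.
move=> /andP[x0 x1]; have := expR_ge1Dx (- x); rewrite expRN.
rewrite -[leRHS]mul1r ler_pdivlMr ?expR_gt0//; have := expR_gt0 x; nra.
Qed.

Lemma expR_sumr (J : Type) (s : seq J) (P : pred J) (f : J -> R) :
  expR (\sum_(j <- s | P j) f j) = \prod_(j <- s | P j) expR (f j).
Proof. exact: (big_morph _ (@expRD R) (@expR0 R)). Qed.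

Lemma prod_le_expR (J : finType) (P : pred J) (f g : J -> R) :
  (forall j, P j -> 0 <= f j <= 1 + g j) ->
  \prod_(j | P j) f j <= expR (\sum_(j | P j) g j).
Proof.
move=> fg; rewrite expR_sumr; apply: ler_prod => j Pj.
have /andP[-> h] := fg j Pj; exact: le_trans h (expR_ge1Dx _).
Qed.

End ExpBounds.

(** * Decay of the product of parity factors over all segments *)

Section ParityDecay.

Variables (R : realType) (m D : nat).
Hypothesis m_gt0 : (0 < m)%N.
Variables (I J : finType) (I2 : {set I}) (U : I -> J -> {set xseg m D}).
Variables (n0 : J -> nat) (q : nat) (G : R).

Local Notation N := #|xvar m D|.

Hypothesis U_disjoint : forall i j j', j != j' -> [disjoint U i j & U i j'].

(** In the application [U i j] is the part of segment [i] held by factor [j], and [n0 j] counts the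
    variables of the factor that are alive whatever the coins; [n c j] is then its number of
    survivors. *)
Let n (c : {ffun I -> seg_coins m D}) j : nat :=
  (n0 j + \sum_i #|survivors (c i) :&: U i j|)%N.

Let chi (A : {set J}) c : R := \prod_(j in A) (-1) ^+ n c j.

(** The keeping probability 1/8 is chosen for this: [1 / 8 * y + 7 / 8] is 3/4 for [y = -1] and 1
    for [y = 1]. *)
Lemma prod_odd_chi c :
  \prod_j (if odd (n c j) then 3 / 4 else 1)
  = \sum_(A in {set J}) subset_weight R A * chi A c.
Proof.
rewrite (eq_bigr (fun A : {set J} => subset_weight R A *
    \prod_j (if j \in A then (-1) ^+ n c j else 1))); last first.
  by move=> A _; rewrite prod_if_in.
rewrite sum_subset_weight; apply: eq_bigr => j _.
by rewrite -signr_odd; case: (odd _) => /=; lra.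
Qed.

Lemma card_sub_bigcup (A : {set J}) i (S : {set xseg m D}) :
  #|S :&: \bigcup_(j in A) U i j| = (\sum_(j in A) #|S :&: U i j|)%N.
Proof.
rewrite big_distrr /= card_bigcup_disjoint// => j j' /(U_disjoint i).
by rewrite -!setI_eq0 setIACA => /eqP->; rewrite setI0.
Qed.

Lemma card_half_bigcup (A : {set J}) i h :
  #|half_section (\bigcup_(j in A) U i j) h|
  = (\sum_(j in A) #|half_section (U i j) h|)%N.
Proof.
have -> : half_section (\bigcup_(j in A) U i j) h
    = \bigcup_(j in A) half_section (U i j) h.
  apply/setP => x; rewrite inE; apply/bigcupP/bigcupP => -[j jA xU];
  by exists j; rewrite // inE in xU *.
apply: card_bigcup_disjoint => j j' /(U_disjoint i).
rewrite -!setI_eq0 => /eqP Ujj'; apply/eqP/setP => x; rewrite !inE.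
by move/setP/(_ (h, x)): Ujj'; rewrite !inE.
Qed.

(** Up to the constant sign [sg], the character [chi A] is a product of one sign per segment, and
    the segments are independent. *)
Lemma norm_Ex_chi (A : {set J}) :
  `|Ex (chi A)| <= \prod_i `|Ex (fun c : seg_coins m D =>
       (-1) ^+ #|survivors c :&: \bigcup_(j in A) U i j|)| :> R.
Proof.
pose sg : R := \prod_(j in A) (-1) ^+ n0 j.
have chiE c : chi A c = sg * \prod_i
    (-1) ^+ #|survivors (c i) :&: \bigcup_(j in A) U i j|.
  rewrite /chi /n; under eq_bigr => j _ do rewrite exprD.
  rewrite big_split /= -/sg; congr (_ * _).
  under eq_bigr => j _ do rewrite -prodrXr.
  rewrite exchange_big /=; apply: eq_bigr => i _.
  by rewrite card_sub_bigcup prodrXr.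
rewrite (eq_Ex chiE) ExZl normrM.
have -> : `|sg| = 1.
  by rewrite normr_prod big1 // => j _; rewrite normrX normrN1 expr1n.
rewrite mul1r (Ex_prod (fun i c => (-1) ^+ #|survivors c :&: _|)).
by rewrite normr_prod.
Qed.

Lemma norm_Ex_sign_le1 (T : finType) (k : T -> nat) :
  `|Ex (fun t => (-1) ^+ k t)| <= 1 :> R.
Proof.
apply: (le_trans (ler_norm_Ex _)); apply: Ex_le_cst => // t.
by rewrite normrX normrN1 expr1n.
Qed.

Hypothesis q_gt0 : (0 < q)%N.
Hypothesis half_le_q :
  forall i j h, i \in I2 -> (#|half_section (U i j) h| <= q)%N.
Hypothesis total_le_N : forall j, (\sum_(i in I2) #|U i j| <= N)%N.
Hypothesis total_ge : G * N%:R <= \sum_j \sum_(i in I2) #|U i j|%:R.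

Let mass j : R := \sum_(i in I2) #|U i j|%:R / N%:R.
(** Scaled so that [t * #|half_section (U i j) h|] is at most 1/2 on [I2], the range of
    [expR_le]. *)
Let t : R := (2 * q%:R)^-1.

(* Exponential moment controlling the sets [A] that fill more than half of a
   half segment, for which the signs of the segment need not average out. *)
Let tail i h (A : {set J}) : R := expR (- (t * (N%:R / 2))) *
  \prod_j (if j \in A then expR (t * #|half_section (U i j) h|%:R) else 1).

Lemma tail_ge0 i h A : 0 <= tail i h A.
Proof.
rewrite mulr_ge0 ?expR_ge0// prodr_ge0// => j _.
by case: ifP => // _; exact: expR_ge0.
Qed.

(** If [A] fills at most half of each half of the segments in [I2], then [Ex_sign_survivors] applies
    to each of them; otherwise the sum of tails exceeds the trivial bound 1. *)
Lemma norm_Ex_chi_le (A : {set J}) :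
  `|Ex (chi A)| <= \prod_j (if j \in A then expR (- (mass j / 3)) else 1)
     + \sum_(i in I2) \sum_h tail i h A.
Proof.
have N0 : 0 < N%:R :> R by rewrite ltr0n xvar_gt0.
have t0 : 0 < t by rewrite invr_gt0 mulr_gt0// ltr0n.
have tails_ge0 i : 0 <= \sum_h tail i h A.
  by apply: sumr_ge0 => h _; apply: tail_ge0.
pose UA i := \bigcup_(j in A) U i j.
have [/forall_inP half|] := boolP [forall (i | i \in I2), [forall h,
    2 * #|half_section (UA i) h| <= N]]%N; last first.
  rewrite negb_forall_in => /exists_inP[i iI2 /forallPn[h]].
  rewrite -ltnNge card_half_bigcup => hN.
  (* The half [h] of segment [i] is overfull, so its [tail] has a nonnegative exponent. *)
  apply: (@le_trans _ _ 1).
    apply: (le_trans (norm_Ex_chi A)); apply: prodr_ile1 => i' _.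
    by rewrite normr_ge0 norm_Ex_sign_le1.
  rewrite -[leLHS]add0r; apply: lerD.
    by apply: prodr_ge0 => j _; case: ifP => // _; exact: expR_ge0.
  rewrite (bigD1 i)//= (bigD1 h)//= -addrA -[leLHS]addr0; apply: lerD.
    rewrite /tail prod_if_in -expR_sumr -expRD -[leLHS]expR0 ler_expR.
    rewrite -mulr_sumr -mulrN -mulrDr mulr_ge0// ?ltW//.
    by move: hN; rewrite -(ltr_nat R) natrM natr_sum; lra.
  by apply: addr_ge0; apply: sumr_ge0 => // h' _; exact: tail_ge0.
rewrite -[leLHS]addr0; apply: lerD; last exact: sumr_ge0.
apply: (le_trans (norm_Ex_chi A)); rewrite prod_if_in -expR_sumr.
rewrite (bigID (mem I2)) /= -[leRHS]mulr1.
apply: ler_pM; [by apply: prodr_ge0|by apply: prodr_ge0| |]; last first.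
  by apply: prodr_ile1 => i' _; rewrite normr_ge0 norm_Ex_sign_le1.
have -> : \sum_(j in A) - (mass j / 3)
    = \sum_(i in I2) - (#|UA i|%:R / (3 * N%:R)).
  rewrite !sumrN -!mulr_suml /mass exchange_big /=; congr (- _).
  under [in LHS]eq_bigr => i _ do rewrite -mulr_suml.
  rewrite -!mulr_suml invfM mulrA [RHS]mulrAC; congr (_ / _ / _).
  apply: eq_bigr => i _; rewrite /UA -natr_sum card_bigcup_disjoint//.
  exact: U_disjoint.
apply: prod_le_expR => i iI2; rewrite normr_ge0 /=.
by apply: Ex_sign_survivors => // h; have /forallP := half i iI2; apply.
Qed.

(** Averages [norm_Ex_chi_le] over the random set [A]; both the main term and the tails then factor
    over [J]. *)
Lemma parity_decay :
  Ex (fun c => \prod_j (if odd (n c j) then 3 / 4 else 1))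
    <= expR (- (G / 48)) + 2 * #|I|%:R * expR (- (N%:R / (8 * q%:R))).
Proof.
have N0 : 0 < N%:R :> R by rewrite ltr0n xvar_gt0.
have q0 : 0 < q%:R :> R by rewrite ltr0n.
have t0 : 0 < t by rewrite invr_gt0 mulr_gt0.
rewrite (eq_Ex prod_odd_chi) Ex_sum.
under eq_bigr => A _ do rewrite ExZl.
apply: (@le_trans _ _ (\sum_(A in {set J}) subset_weight R A *
   (\prod_j (if j \in A then expR (- (mass j / 3)) else 1)
     + \sum_(i in I2) \sum_h tail i h A))).
  apply: ler_sum => A _; apply: ler_wpM2l; first exact: subset_weight_ge0.
  exact: le_trans (ler_norm _) (norm_Ex_chi_le A).
under eq_bigr => A _ do rewrite mulrDr.
rewrite big_split /= sum_subset_weight; apply: lerD.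
  (* One factor contributes [1 / 8 * exp (- mass / 3) + 7 / 8 <= 1 - mass / 48]; [expRN_le] applies
     since [total_le_N] gives [mass j <= 1]. *)
  apply: (@le_trans _ _ (expR (\sum_j - (mass j / 48)))).
    apply: prod_le_expR => j _.
    have e0 := expR_ge0 (- (mass j / 3)).
    have mj : 0 <= mass j / 3 <= 1.
      rewrite divr_ge0 ?sumr_ge0//= => [|i _]; last by rewrite divr_ge0.
      rewrite ler_pdivrMr// /mass -mulr_suml ler_pdivrMr// -natr_sum.
      have := total_le_N j; rewrite -(ler_nat R). lra.
    by have := expRN_le mj; move=> ?; apply/andP; split; lra.
  rewrite ler_expR sumrN lerN2 -mulr_suml ler_wpM2r ?invr_ge0//.
  rewrite /mass; under eq_bigr do rewrite -mulr_suml.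
  by rewrite -mulr_suml ler_pdivlMr.
(* One factor contributes at most [1 + t * w j / 4], and the [w j] sum to at most [N]. The exponent
   is thus at most [- t * N / 2 + t * N / 4], which is [- N / (8 * q)]. *)
have tail_le i h : i \in I2 ->
    \sum_(A in {set J}) subset_weight R A * tail i h A
    <= expR (- (N%:R / (8 * q%:R))).
  move=> iI2; under eq_bigr => A _ do rewrite /tail mulrCA.
  rewrite -mulr_sumr sum_subset_weight.
  set w := fun j => #|half_section (U i j) h|%:R : R.
  apply: (@le_trans _ _ (expR (- (t * (N%:R / 2))) *
      expR (\sum_j t * w j / 4))).
    apply: ler_wpM2l; first exact: expR_ge0.
    apply: prod_le_expR => j _; have e0 := expR_ge0 (t * w j).
    have tw : 0 <= t * w j <= 1 / 2.
      apply/andP; split; first by apply: mulr_ge0 => //; exact: ltW.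
      have : w j <= q%:R by rewrite ler_nat half_le_q.
      have -> : 1 / 2 = t * q%:R by rewrite /t; field; rewrite gt_eqF.
      by move=> ?; apply: ler_wpM2l => //; apply: ltW.
    by have := expR_le tw; rewrite -/(w j) => ?; apply/andP; split; lra.
  rewrite -expRD ler_expR -mulr_suml -mulr_sumr.
  have : \sum_j w j <= N%:R.
    rewrite -natr_sum ler_nat.
    have -> : (\sum_j #|half_section (U i j) h|
        = \sum_(j in [set: J]) #|half_section (U i j) h|)%N.
      by apply: eq_bigl => j; rewrite inE.
    by rewrite -card_half_bigcup max_card.
  set W := \sum_j _ => WN.
  have -> : N%:R / (8 * q%:R) = t * (N%:R / 4) by rewrite /t; field; rewrite gt_eqF.
  by nra.
under eq_bigr => A _ do rewrite mulr_sumr.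
rewrite exchange_big /=.
apply: (@le_trans _ _ (\sum_(i in I2) 2 * expR (- (N%:R / (8 * q%:R))))).
  apply: ler_sum => i iI2; under eq_bigr => A _ do rewrite mulr_sumr.
  rewrite exchange_big /= big_ord_recl big_ord1 mulrDl !mul1r.
  by apply: lerD; apply: tail_le.
rewrite sumr_const -[leLHS]mulr_natr mulrAC ler_wpM2r ?expR_ge0//.
by rewrite ler_wpM2l// ler_nat max_card.
Qed.

End ParityDecay.

(** * Mass on the active halves *)

Section ActiveHalves.

Variables (R : realType) (m D : nat).
Hypothesis m_gt0 : (0 < m)%N.

(* [z] is the value under option [E_3], where no half is active. *)
Definition at_active T (z : T) (w : 'I_2 -> T) (c : seg_coins m D) : T :=
  if (val c.1.1 < 2)%N then w (half_of c.1.1) else z.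

Lemma Ex_at_active (z : R) (w : 'I_2 -> R) :
  Ex (at_active z w) = (w fst_half + w snd_half + z) / 3.
Proof.
have r0 : (0 < #|rho_coins m D|)%N.
  by move: (seg_coins_gt0 D m_gt0); rewrite !card_prod !muln_gt0 -andbA => /and3P[].
have x0 : (0 < #|{: xvar m D * xvar m D}|)%N by rewrite card_prod muln_gt0 xvar_gt0.
pose f (e : 'I_3) := if (val e < 2)%N then w (half_of e) else z.
rewrite Ex_pair (eq_Ex (g := fun er => f er.1)); last first.
  by move=> er; rewrite (eq_Ex (g := fun _ => f er.1)) ?Ex_cst.
rewrite Ex_pair (eq_Ex (g := f)); last first.
  by move=> e; rewrite (eq_Ex (g := fun _ => f e)) ?Ex_cst.
by rewrite /Ex card_ord !big_ord_recl big_ord0 addr0 addrA.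
Qed.

Variables (I : finType).

(** Each designated half is active with probability 1/3, independently over the segments. *)
Lemma prob_no_active_half (I1 : {set I}) (h : I -> 'I_2) :
  prob R (fun c : {ffun I -> seg_coins m D} =>
    [forall (i | i \in I1), ~~ at_active false (fun h' => h' == h i) (c i)])
  <= (2 / 3) ^+ #|I1|.
Proof.
rewrite prob_Ex; apply: (@le_trans _ _ (Ex (fun c : {ffun I -> seg_coins m D} =>
  \prod_i (if i \in I1 then at_active 1 (fun h' => (h' != h i)%:R) (c i) else 1 : R)))).
  apply: ler_Ex => c; case: forall_inP => /= [nh|_].
    rewrite big1 // => i _; case: ifP => // /nh.
    by rewrite /at_active; case: ifP => // _ ->.
  apply: prodr_ge0 => i _; case: ifP => // _.
  by rewrite /at_active; case: ifP.
rewrite (Ex_prod (fun i c => if i \in I1 then at_active 1 (fun h' => (h' != h i)%:R) c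
   else 1)) (bigID (mem I1)) /= -[leRHS]mulr1 -prodr_const.
apply: ler_pM; rewrite ?prodr_ge0//.
- by move=> i _; apply: Ex_ge0 => c; case: ifP => // _; rewrite /at_active; case: ifP.
- by move=> i _; apply: Ex_ge0 => c; case: ifP => // _; rewrite /at_active; case: ifP.
- apply: ler_prod => i ->; rewrite Ex_at_active.
  by case: (half_cases (h i)) => -> /=; apply/andP; split; lra.
- apply: prodr_ile1 => i /negbTE ->.
  by rewrite Ex_ge0//=; apply: Ex_le_cst.
Qed.

(** Chernoff bound: Markov for [exp (- sum / q)] at the threshold [exp (-1)], the source of the 1 in
    the exponent. A weight [b = W i h / q] is at most 1, so [expRN_le] bounds the factor of a
    segment by [1 - (b0 + b1) / 6]. *)
Lemma prob_active_sum_lt (I2 : {set I}) (W : I -> 'I_2 -> nat) (q : nat) :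
  (0 < q)%N -> (forall i h, i \in I2 -> W i h <= q)%N ->
  prob R (fun c : {ffun I -> seg_coins m D} =>
    (\sum_i at_active 0 (W i) (c i) < q)%N)
  <= expR (1 - (\sum_(i in I2) \sum_h W i h)%:R / (6 * q%:R)).
Proof.
move=> q_gt0 Wq; have q0 : 0 < q%:R :> R by rewrite ltr0n.
pose g i (c : seg_coins m D) : R := if i \in I2 then
  expR (- ((at_active 0%N (W i) c)%:R / q%:R)) else 1.
have g0 i c : 0 <= g i c by rewrite /g; case: ifP => _; rewrite ?expR_ge0.
apply: (le_trans (@markov _ _ (expR (-1)) _
   (fun c : {ffun I -> seg_coins m D} => \prod_i g i (c i)) (expR_gt0 _) _ _)).
- by move=> c; apply: prodr_ge0.
- move=> c; rewrite -(ltr_nat R) => sum_lt.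
  rewrite /g -(big_mkcond (mem I2)) -expR_sumr ler_expR sumrN lerN2 -mulr_suml.
  rewrite ler_pdivrMr// mul1r; apply: le_trans (ltW sum_lt).
  rewrite natr_sum [leRHS](bigID (mem I2)) /= lerDl sumr_ge0//.
rewrite Ex_prod expRN invrK addrC expRD ler_wpM2r ?expR_ge0//.
rewrite (bigID (mem I2)) /= -[leRHS]mulr1 natr_sum mulr_suml -sumrN.
apply: ler_pM; rewrite ?prodr_ge0//; try by move=> i _; exact: Ex_ge0.
  apply: prod_le_expR => i iI2; rewrite Ex_ge0//=.
  pose b h : R := (W i h)%:R / q%:R.
  have b01 h : 0 <= b h <= 1.
    apply/andP; split; first exact: divr_ge0.
    by rewrite ler_pdivrMr// mul1r ler_nat Wq.
  rewrite (eq_Ex (g := at_active 1 (fun h => expR (- b h)))); last first.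
    move=> c; rewrite /g iI2 /at_active; case: ifP => //.
    by rewrite mul0r oppr0 expR0.
  rewrite Ex_at_active big_ord_recl big_ord1 natrD.
  have -> : lift ord0 ord0 = snd_half by apply: val_inj.
  have := expRN_le (b01 fst_half); have := expRN_le (b01 snd_half).
  have -> : ((W i ord0)%:R + (W i snd_half)%:R) / (6 * q%:R)
     = (b fst_half + b snd_half) / 6 :> R.
    by rewrite /b; field; rewrite gt_eqF.
  lra.
apply: prodr_ile1 => i /negbTE iI2; rewrite Ex_ge0//=.
by apply: Ex_le_cst => // c; rewrite /g iI2.
Qed.

End ActiveHalves.

(** * The bound on the relative rank, and subsegments *)

Section RankBound.

Variables (R : realType) (F : fieldType) (V : finType).

Definition parity_bound (al U : {set V}) : R :=
  if odd #|U :&: al| then 3 / 4 else 1.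

(* Bounds the relative rank of a (Sigma Pi)^D Sigma formula after a restriction
   under which the set of surviving variables is [al]. *)
Fixpoint rank_bound (D : nat) (al : {set V}) (f : formula F V) : R :=
  if D is D'.+1 then
    if f is Sum _ s then
      \sum_(c <- s) if c.2 is Prod _ t then
        \prod_(g <- t) Num.min (parity_bound al (Vars g)) (rank_bound D' al g)
      else 0
    else 0
  else 2 * (3 / 4) ^+ #|Vars f :&: al|.

Definition factor_bound D al f : R :=
  Num.min (parity_bound al (Vars f)) (rank_bound D al f).

Lemma parity_bound_ge0 al U : 0 <= parity_bound al U.
Proof. by rewrite /parity_bound; case: ifP => _; lra. Qed.

Lemma parity_bound_le1 al U : parity_bound al U <= 1.
Proof. by rewrite /parity_bound; case: ifP => _; lra. Qed.

Lemma rank_bound_ge0 D al f : 0 <= rank_bound D al f.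
Proof.
elim: D f => [|D IH] f /=; first by rewrite mulr_ge0// exprn_ge0// divr_ge0.
case: f => // _ s; apply: sumr_ge0 => -[a [| | |A t]] _ //=.
by apply: prodr_ge0 => g _; rewrite le_min parity_bound_ge0 IH.
Qed.

Lemma factor_bound_ge0 D al f : 0 <= factor_bound D al f.
Proof. by rewrite le_min parity_bound_ge0 rank_bound_ge0. Qed.

Lemma factor_bound_le1 D al f : factor_bound D al f <= 1.
Proof. by rewrite ge_min parity_bound_le1. Qed.

Lemma factor_bound_le_rank D al f : factor_bound D al f <= rank_bound D al f.
Proof. by rewrite ge_min lexx orbT. Qed.

Lemma factor_bound_le_parity D al f :
  factor_bound D al f <= parity_bound al (Vars f).
Proof. by rewrite ge_min lexx. Qed.

Variables (m : nat).

Section Alive.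

Variables (D : nat) (I : finType) (I0 : {set I}) (iota : I -> xseg m D -> V).

(** Segments are abstract: [iota] places them among the variables. Only the indices in [I0] are in
    use, so that the subsegments of active halves can be indexed by the whole type [I * 'I_m]. [Fix]
    collects the variables that are alive whatever the coins. *)
Definition alive (Fix : {set V}) (c : {ffun I -> seg_coins m D}) : {set V} :=
  Fix :|: \bigcup_(i in I0) [set iota i x | x in survivors (c i)].

Definition trace (U : {set V}) (i : I) : {set xseg m D} :=
  if i \in I0 then [set x | iota i x \in U] else set0.

Definition embeds_segments : Prop :=
  forall i i' x x', i \in I0 -> i' \in I0 -> iota i x = iota i' x' ->
  i = i' /\ x = x'.

Definition avoids_segments (Fix : {set V}) : Prop :=
  forall i x, i \in I0 -> iota i x \notin Fix.

Hypothesis iota_inj : embeds_segments.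

Lemma trace_disjoint (U U' : {set V}) i :
  [disjoint U & U'] -> [disjoint trace U i & trace U' i].
Proof.
rewrite -!setI_eq0 /trace => /eqP UU'; case: ifP => _; last by rewrite setI0.
by apply/eqP/setP => x; rewrite !inE -in_setI UU' inE.
Qed.

Lemma trace_bigcup (J : finType) (U : J -> {set V}) i :
  trace (\bigcup_j U j) i = \bigcup_j trace (U j) i.
Proof.
apply/setP => x; rewrite /trace; case: ifP => _.
  rewrite inE; apply/bigcupP/bigcupP => -[j _ xU]; exists j => //.
    by rewrite inE.
  by rewrite inE in xU.
by rewrite big1_eq.
Qed.

(** Splits the count into a constant and one term per segment, the shape that [parity_decay]
    expects. *)
Lemma card_alive Fix (U : {set V}) c : avoids_segments Fix ->
  #|U :&: alive Fix c|
  = (#|U :&: Fix| + \sum_i #|survivors (c i) :&: trace U i|)%N.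
Proof.
move=> Fix_off; pose S i := [set iota i x | x in survivors (c i) :&: trace U i].
have SU v i : v \in S i -> i \in I0 /\ exists2 x, x \in survivors (c i) & v = iota i x.
  case/imsetP => x; rewrite in_setI /trace; case: ifP => iI0; last first.
    by rewrite in_set0 andbF.
  by move=> /andP[xs _] ->; split=> //; exists x.
have -> : U :&: alive Fix c = (U :&: Fix) :|: \bigcup_i S i.
  apply/setP => v; rewrite !inE andb_orr; congr (_ || _).
  apply/andP/bigcupP => [[vU /bigcupP[i iI0 /imsetP[x xs vx]]]|[i _ vS]].
    exists i => //; apply/imsetP; exists x => //.
    by rewrite in_setI xs /trace iI0 in_set -vx vU.
  have [iI0 _] := SU _ _ vS; case/imsetP: vS => x.
  rewrite in_setI /trace iI0 => /andP[xs xU] ->; split; first by rewrite inE in xU.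
  by apply/bigcupP; exists i => //; apply: imset_f.
rewrite cardsU; have -> : U :&: Fix :&: \bigcup_i S i = set0.
  apply/setP => v; rewrite !inE; apply/negP => /andP[/andP[_ vF]].
  case/bigcupP => i _ /SU[iI0 [x _ vx]].
  by move: (Fix_off i x iI0); rewrite -vx vF.
rewrite cards0 subn0; congr (_ + _)%N.
rewrite card_bigcup_disjoint => [|i i' ii'].
  apply: eq_bigr => i _; apply: card_in_imset => x x'.
  rewrite !in_setI /trace; case: ifP => iI0; last by rewrite in_set0 andbF.
  by move=> _ _ /(iota_inj iI0 iI0)[].
rewrite -setI_eq0; apply/eqP/setP => v; rewrite !inE; apply/negP.
case/andP => /SU[iI0 [x _ ->]] /SU[i'I0 [x' _]] /(iota_inj iI0 i'I0)[].
by move/eqP; rewrite (negPf ii').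
Qed.

End Alive.

(* The coins of the copies of [rho] are resampled; option and edges of [E_3] are
   kept. *)
Definition renew D (I : finType) (c : {ffun I -> seg_coins m D.+1})
    (r : {ffun I * 'I_m -> seg_coins m D}) : {ffun I -> seg_coins m D.+1} :=
  [ffun i => ((c i).1.1, [ffun l => r (i, l)], (c i).2)].

Definition renewed D (I : finType) (c : {ffun I -> seg_coins m D.+1}) :
    {ffun I * 'I_m -> seg_coins m D} :=
  [ffun p => ((c p.1).1.2 : {ffun 'I_m -> seg_coins m D}) p.2].

Lemma renewK D (I : finType) (c : {ffun I -> seg_coins m D.+1}) r :
  renew (renew c r) (renewed c) = c.
Proof.
apply/ffunP => i; rewrite !ffunE /=.
have -> : [ffun l => renewed c (i, l)] = (c i).1.2.
  by apply/ffunP => l; rewrite !ffunE.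
by case: (c i) => -[].
Qed.

Lemma renewedK D (I : finType) (c : {ffun I -> seg_coins m D.+1}) r :
  renewed (renew c r) = r.
Proof. by apply/ffunP => -[i l]; rewrite !ffunE /= ?ffunE. Qed.

Section Subsegments.

Variables (D : nat) (I : finType) (I0 : {set I}) (iota : I -> xseg m D.+1 -> V).
Variables (Fix : {set V}) (c : {ffun I -> seg_coins m D.+1}).
Hypothesis iota_inj : embeds_segments I0 iota.
Hypothesis Fix_off : avoids_segments I0 iota Fix.

Definition active : {set I * 'I_m} :=
  [set p | (p.1 \in I0) && (val (c p.1).1.1 < 2)%N].

Definition sub_iota (p : I * 'I_m) (x : xseg m D) : V :=
  iota p.1 (half_of (c p.1).1.1, (p.2, x)).

(** Once the options and the edges of [E_3] are given, the survivors of the segments under [E_3] are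
    constant and join [Fix]. *)
Definition sub_Fix : {set V} :=
  Fix :|: \bigcup_(i in I0 | ~~ (val (c i).1.1 < 2)%N)
            [set iota i x | x in survivors (c i)].

Lemma sub_iota_inj : embeds_segments active sub_iota.
Proof.
move=> [i l] [i' l'] x x'; rewrite !inE /= => /andP[iI0 _] /andP[i'I0 _].
by case/(iota_inj iI0 i'I0) => <- [-> ->].
Qed.

Lemma sub_Fix_off : avoids_segments active sub_iota sub_Fix.
Proof.
move=> [i l] x; rewrite !inE /= => /andP[iI0 ei]; rewrite negb_or Fix_off//=.
apply/negP => /bigcupP[i' /andP[i'I0 ei'] /imsetP[x' _]].
by case/(iota_inj iI0 i'I0) => ii' _; rewrite -ii' ei in ei'.
Qed.

(** Self-similarity: after conditioning, the alive set has the same form one level lower, over the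
    subsegments of the active halves. *)
Lemma alive_renew r :
  alive I0 iota Fix (renew c r) = alive active sub_iota sub_Fix r.
Proof.
have E3 i : ~~ (val (c i).1.1 < 2)%N -> survivors (renew c r i) = survivors (c i).
  rewrite /renew ffunE; case: (c i) => -[e rr] [x1 x2] /= e2.
  case: (option_cases e) e2 => [->//|->] _.
  exact: etrans (survivors_E3 _ _ _) (esym (survivors_E3 _ _ _)).
have E12 i h l x : (val (c i).1.1 < 2)%N ->
    ((h, (l, x)) \in survivors (renew c r i))
    = (h == half_of (c i).1.1) && (x \in survivors (r (i, l))).
  by move=> e2; rewrite /renew ffunE survivors_E12_S// ffunE.
rewrite /alive /sub_Fix -setUA; congr (_ :|: _); apply/setP => v.
rewrite inE; apply/bigcupP/orP => [[i iI0 /imsetP[[h [l x]] xs ->]]|].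
  have [e2|e2] := boolP (val (c i).1.1 < 2)%N; [right|left].
    move: xs; rewrite E12// => /andP[/eqP-> xs].
    by apply/bigcupP; exists (i, l); [rewrite inE/= iI0|apply/imsetP; exists x].
  by apply/bigcupP; exists i; [rewrite iI0|apply/imset_f; rewrite -E3].
case=> /bigcupP[].
  by move=> i /andP[iI0 e2] vs; exists i => //; rewrite E3.
move=> [i l]; rewrite inE /= => /andP[iI0 e2] /imsetP[x xs ->].
by exists i => //; apply/imset_f; rewrite E12// eqxx.
Qed.

Lemma card_sub_trace U :
  (\sum_p #|trace active sub_iota U p|
   = \sum_i at_active 0 (fun h => #|half_section (trace I0 iota U i) h|) (c i))%N.
Proof.
rewrite (eq_bigr (fun p => #|trace active sub_iota U (p.1, p.2)|)); last by case.
rewrite -(pair_big xpredT xpredT (fun i l => #|trace active sub_iota U (i, l)|)) /=.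
apply: eq_bigr => i _; rewrite /trace /at_active.
have [e2|e2] := boolP (val (c i).1.1 < 2)%N; last first.
  by rewrite big1 // => l _; rewrite inE /= (negPf e2) andbF cards0.
have [iI0|iI0] := boolP (i \in I0); last first.
  rewrite big1 => [|l _]; last by rewrite inE /= (negPf iI0) cards0.
  by symmetry; apply/eqP; rewrite cards_eq0; apply/eqP/setP => x; rewrite !inE.
rewrite -[RHS]sum1_card (eq_bigl (fun p : 'I_m * xseg m D =>
   (half_of (c i).1.1, (p.1, p.2)) \in [set x | iota i x \in U])); last first.
  by move=> [l x]; rewrite !inE.
rewrite -(pair_big_dep xpredT (fun l x => (half_of (c i).1.1, (l, x))
   \in [set x | iota i x \in U]) (fun _ _ => 1%N)) /=.
apply: eq_bigr => l _; rewrite inE /= iI0 e2 sum1_card; apply: eq_card => x.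
rewrite inE; exact: (esym (in_set (fun y => iota i y \in U) _)).
Qed.

End Subsegments.

End RankBound.

Section Numbers.

Variable R : realType.

Lemma expR_natN_le (n : nat) : expR (- n%:R) <= (1 / 2) ^+ n :> R.
Proof.
have e1 : expR (-1) <= 1 / 2 :> R.
  rewrite expRN -[leRHS]invrK lef_pV2 ?posrE ?expR_gt0 ?invr_gt0 ?divr_gt0//.
  have := expR_ge1Dx (1 : R); lra.
have -> : - n%:R = n%:R * -1 :> R by ring.
by rewrite expRM_natl lerXn2r// ?nnegrE ?expR_ge0// divr_ge0.
Qed.

End Numbers.

(** * Products at depth at least two *)

Section ProductStep.

Variables (R : realType) (F : fieldType) (V : finType) (m T Q B s : nat).

Let eta : R := (1 / 2) ^+ T.

Hypothesis m_gt0 : (0 < m)%N.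
Hypothesis s_gt0 : (0 < s)%N.
Hypothesis B_gt0 : (0 < B)%N.
Hypothesis Q_ge : (100 * T + 48 <= Q)%N.
Hypothesis B_le : B%:R <= expR (m%:R / (4 * Q%:R) - (2 * T + 2)%:R) :> R.

(** [#|I| * m ^ D] does not change when [D] drops by one and [I] becomes [I * 'I_m], so one bound
    [B] serves every depth. Segments, embedding and [Fix] are quantified because conditioning
    changes them. *)
Definition depth_claim D : Prop :=
  forall (I : finType) (I0 : {set I}) (iota : I -> xseg m D -> V)
    (Fix : {set V}) (f : formula F V),
  embeds_segments I0 iota -> avoids_segments I0 iota Fix ->
  SigmaPiSigma D.+1 f -> variable_labelled f -> (fsize f <= s)%N ->
  (#|I| * m ^ D <= B)%N ->
  (Q * #|xvar m D| <= \sum_i #|trace I0 iota (Vars f) i|)%N ->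
  prob R (fun c => (s ^ D.+1)%:R * eta <= rank_bound R D.+1 (alive I0 iota Fix c) f)
    <= D.+1%:R * ((s ^ D.+1)%:R * eta).

Lemma eta_gt0 : 0 < eta. Proof. by rewrite exprn_gt0 ?divr_gt0. Qed.

Lemma eta_ge0 : 0 <= eta. Proof. exact: ltW eta_gt0. Qed.

Lemma eta_le_pow k : eta <= (s ^ k)%:R * eta.
Proof. by rewrite ler_peMl ?eta_ge0// ler1n expn_gt0 s_gt0. Qed.

Variables (D : nat) (I J : finType) (I0 : {set I}) (iota : I -> xseg m D.+1 -> V).
Variables (Fix : {set V}) (g : J -> formula F V).
Hypothesis iota_inj : embeds_segments I0 iota.
Hypothesis Fix_off : avoids_segments I0 iota Fix.
Hypothesis g_disjoint : forall j j', j != j' -> [disjoint Vars (g j) & Vars (g j')].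
Hypothesis g_depth : forall j, SigmaPiSigma D.+1 (g j).
Hypothesis g_vl : forall j, variable_labelled (g j).
Hypothesis g_size : forall j, (fsize (g j) <= s)%N.
Hypothesis I_le : (#|I| * m ^ D.+1 <= B)%N.
Hypothesis mass_ge :
  (Q * #|xvar m D.+1| <= \sum_i \sum_j #|trace I0 iota (Vars (g j)) i|)%N.

Let N := #|xvar m D.+1|.
(** The mass that the induction hypothesis asks for one level lower. Since
    [N = 2 * m * #|xvar m D|], it is the fraction [Q / 2m] of a half. *)
Let q := (Q * #|xvar m D|)%N.
Let w i j h := #|half_section (trace I0 iota (Vars (g j)) i) h|.
Let level : R := (s ^ D.+1)%:R * eta.
Let bad (c : {ffun I -> seg_coins m D.+1}) : bool :=
  level <= \prod_j factor_bound R D.+1 (alive I0 iota Fix c) (g j).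
(** Some factor has enough mass on the active halves for the induction hypothesis. Only the options
    matter here, so [renew] preserves it. *)
Let good (c : {ffun I -> seg_coins m D.+1}) : bool :=
  [exists j, q <= \sum_i at_active 0 (w i j) (c i)]%N.

Lemma card_xvarS : N = (2 * m * #|xvar m D|)%N.
Proof. by rewrite /N /= !card_prod !card_ord mulnA [(m * 2)%N]mulnC. Qed.

Lemma Q_gt0 : (0 < Q)%N. Proof. lia. Qed.

Lemma q_gt0 : (0 < q)%N. Proof. by rewrite muln_gt0 Q_gt0 xvar_gt0. Qed.

(** Condition on the options and the edges of [E_3]. If these are good for a factor [j], the renewed
    coins are those of [depth_claim D] for [g j]. *)
Lemma prob_bad_le_good : depth_claim D ->
  prob R bad <= prob R (fun c => ~~ good c) + D.+1%:R * level.
Proof.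
move=> IH.
apply: (@le_trans _ _ (prob R (fun c => ~~ good c || good c && bad c))).
  by apply: prob_le => c ->; rewrite andbT orNb.
apply: (le_trans (prob_or _ _ _)); rewrite lerD2l prob_Ex.
rewrite (@Ex_resample _ _ _ (@renew m D I) (@renewed m D I)); last first.
- exact: renewedK.
- exact: renewK.
- by rewrite card_ffun expn_gt0 seg_coins_gt0.
have level0 : 0 <= level by exact: mulr_ge0 (ler0n _ _) eta_ge0.
have rhs0 : 0 <= D.+1%:R * level by exact: mulr_ge0.
apply: Ex_le_cst => [//|c].
have good_renew r : good (renew c r) = good c.
  apply: eq_existsb => j; congr (_ <= _)%N; apply: eq_bigr => i _.
  by rewrite /at_active /renew ffunE.
have [/existsP[j qj]|ng] := boolP (good c); last first.
  by rewrite /Ex big1 ?mul0r// => r _; rewrite good_renew (negPf ng).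
rewrite -(prob_Ex R (fun r => good (renew c r) && bad (renew c r))).
apply: le_trans (IH _ _ _ (sub_Fix I0 iota Fix c) _
  (sub_iota_inj (c := c) iota_inj) (sub_Fix_off (c := c) iota_inj Fix_off)
  (g_depth j) (g_vl j) (g_size j) _ _).
(* The other factors are at most 1, so a bad product forces the rank bound of [g j] up to
   [level]. *)
- apply: prob_le => r /andP[_]; rewrite /bad alive_renew => le_prod.
  apply: (le_trans le_prod); rewrite (bigD1 j)//= -[leRHS]mulr1.
  apply: ler_pM; rewrite ?factor_bound_ge0 ?factor_bound_le_rank//.
    by apply: prodr_ge0 => j' _; apply: factor_bound_ge0.
  by apply: prodr_ile1 => j' _; rewrite factor_bound_ge0 factor_bound_le1.
- by rewrite card_prod card_ord -mulnA -expnS.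
- by rewrite card_sub_trace.
Qed.

(* The segments on which some factor is heavy. *)
Let I1 : {set I} := [set i | [exists j, [exists h, q <= w i j h]]]%N.

(** One heavy half is designated in each segment of [I1]; a single active one suffices. The bound
    follows from [(2 / 3) ^ 2 <= 1 / 2]. *)
Lemma prob_not_good_many : (2 * T <= #|I1|)%N -> prob R (fun c => ~~ good c) <= eta.
Proof.
move=> T_le.
have [h hP] : exists h : I -> 'I_2, forall i, i \in I1 -> [exists j, q <= w i j (h i)]%N.
  apply: (@fin_all_exists I (fun _ => 'I_2)
    (fun i h => i \in I1 -> [exists j, q <= w i j h]%N)) => i.
  have [|_] := boolP (i \in I1); last by exists ord0.
  by rewrite inE => /existsP[j /existsP[h qh]]; exists h => _; apply/existsP; exists j.
apply: (@le_trans _ _ ((2 / 3) ^+ #|I1|)).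
  apply: le_trans (prob_no_active_half R D.+1 m_gt0 I1 h); apply: prob_le => c.
  apply: contraR => /forall_inPn[i iI1]; rewrite negbK /at_active => ei.
  have /existsP[j qj] := hP i iI1; apply/existsP; exists j.
  apply: (leq_trans qj); rewrite (bigD1 i)//= /at_active.
  by case: ifP ei => // _ /eqP->; exact: leq_addr.
apply: (@le_trans _ _ ((2 / 3) ^+ (2 * T))); first by apply: ler_wiXn2l => //; lra.
rewrite exprM /eta lerXn2r ?nnegrE ?exprn_ge0 ?divr_ge0//; lra.
Qed.

Lemma BigQ : (2 * T + 2)%:R <= m%:R / (4 * Q%:R) :> R.
Proof.
rewrite -subr_ge0 -(ler_expR 0) expR0; apply: le_trans B_le.
by rewrite ler1n.
Qed.

(** Off [I1] no half holds more than [q], so [prob_active_sum_lt] applies. Its exponent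
    [N / (6 * q)] is [4 / 3] times [m / (4 * Q)], which is at least [2 * T + 2] by [BigQ]. *)
Lemma prob_not_good_mass j : (N < \sum_(i in ~: I1) \sum_h w i j h)%N ->
  prob R (fun c => ~~ good c) <= eta.
Proof.
move=> N_lt.
have w_le i h : i \in ~: I1 -> (w i j h <= q)%N.
  rewrite !inE negb_exists => /forallP/(_ j); rewrite negb_exists.
  by move/forallP/(_ h); rewrite -ltnNge => /ltnW.
apply: (@le_trans _ _ (prob R (fun c : {ffun I -> seg_coins m D.+1} =>
    (\sum_i at_active 0 (w i j) (c i) < q)%N))).
  by apply: prob_le => c; rewrite negb_exists => /forallP/(_ j); rewrite -ltnNge.
apply: (le_trans (@prob_active_sum_lt R m D.+1 m_gt0 I (~: I1) (w^~ j) q q_gt0 w_le)).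
apply: le_trans (expR_natN_le R T); rewrite ler_expR.
have q0 : 0 < q%:R :> R by rewrite ltr0n q_gt0.
have Q0 : 0 < Q%:R :> R by rewrite ltr0n Q_gt0.
have N'0 : 0 < #|xvar m D|%:R :> R by rewrite ltr0n xvar_gt0.
apply: (@le_trans _ _ (1 - N%:R / (6 * q%:R))).
  rewrite lerD2l lerN2 ler_wpM2r ?invr_ge0 ?mulr_ge0//.
  by rewrite ler_nat ltnW.
have -> : N%:R / (6 * q%:R) = m%:R / (4 * Q%:R) * (4 / 3) :> R.
  rewrite card_xvarS /q !natrM; field; by rewrite !gt_eqF.
have := BigQ; rewrite natrD natrM; have : 0 <= T%:R :> R by []. lra.
Qed.

Lemma card_I1_mass :
  (\sum_(i in I1) \sum_j #|trace I0 iota (Vars (g j)) i| <= 2 * N * #|I1|)%N.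
Proof.
rewrite mulnC -sum_nat_const; apply: leq_sum => i _.
rewrite -(@card_bigcup_disjoint _ _ predT (fun j => trace I0 iota (Vars (g j)) i)).
  by apply: (leq_trans (max_card _)); rewrite /= card_prod card_ord.
by move=> j j' jj'; apply: trace_disjoint; apply: g_disjoint.
Qed.

(** Markov at the threshold [eta] for the product of the parity factors, so [parity_decay] has to
    yield [eta * eta]. *)
Lemma prob_bad_spread : (#|I1| < 2 * T)%N ->
  (forall j, \sum_(i in ~: I1) \sum_h w i j h <= N)%N -> prob R bad <= eta.
Proof.
move=> I1_lt N_ge.
have wE i j : (\sum_h w i j h = #|trace I0 iota (Vars (g j)) i|)%N.
  rewrite -card_half_section big_ord_recl big_ord1; congr (_ + _)%N.
  by congr #|half_section _ _|; apply: val_inj.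
pose par c j : R := if odd (#|Vars (g j) :&: Fix|
   + \sum_i #|survivors (c i) :&: trace I0 iota (Vars (g j)) i|) then 3 / 4 else 1.
have bad_par c : bad c -> eta <= \prod_j par c j.
  move=> bc; apply: (le_trans (eta_le_pow D.+1)); apply: (le_trans bc).
  apply: ler_prod => j _; rewrite factor_bound_ge0 /=.
  apply: (le_trans (factor_bound_le_parity _ _ _ _)).
  by rewrite /parity_bound /par card_alive.
have par_ge0 c : 0 <= \prod_j par c j.
  by apply: prodr_ge0 => j _; rewrite /par; case: ifP => _; lra.
apply: (le_trans (@markov R _ eta bad _ eta_gt0 par_ge0 bad_par)).
rewrite ler_pdivrMr ?eta_gt0//.
have Q0 : 0 < Q%:R :> R by rewrite ltr0n Q_gt0.
have N'0 : 0 < #|xvar m D|%:R :> R by rewrite ltr0n xvar_gt0.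
(* Fewer than [2 * T] segments are discarded, each of mass at most [2 * N]; mass [(Q - 4 * T) * N]
   remains. *)
have := @parity_decay R m D.+1 m_gt0 I J (~: I1)
  (fun i j => trace I0 iota (Vars (g j)) i) (fun j => #|Vars (g j) :&: Fix|) q
  (Q%:R - 4 * T%:R) _ q_gt0 _ _ _.
move=> pd; apply: le_trans (pd _ _ _ _) _ => {pd}.
- by move=> i j j' jj'; apply: trace_disjoint; apply: g_disjoint.
- move=> i j h; rewrite !inE negb_exists => /forallP/(_ j); rewrite negb_exists.
  by move/forallP/(_ h); rewrite -ltnNge => /ltnW.
- by move=> j; under eq_bigr do rewrite -wE.
- under eq_bigr do rewrite -natr_sum.
  rewrite -natr_sum exchange_big /=.
  have : (Q * N <= \sum_(i in ~: I1) \sum_j #|trace I0 iota (Vars (g j)) i|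
      + 4 * T * N)%N.
    apply: (leq_trans mass_ge); rewrite (bigID (mem I1)) /= addnC leq_add//.
      by rewrite [leqRHS](eq_bigl (fun i => i \notin I1))// => i; rewrite in_setC.
    apply: (leq_trans card_I1_mass); move: I1_lt; nia.
  by rewrite -(ler_nat R) natrD !natrM -/N; lra.
have -> : N%:R / (8 * q%:R) = m%:R / (4 * Q%:R) :> R.
  rewrite card_xvarS /q !natrM; field; by rewrite !gt_eqF.
have e2 n : (1 / 2) ^+ (2 * n) = (1 / 2) ^+ n * (1 / 2) ^+ n :> R.
  by rewrite mul2n -addnn exprD.
(* [Q >= 100 * T + 48] gives [(Q - 4 * T) / 48 >= 2 * T + 1]. *)
have h1 : expR (- ((Q%:R - 4 * T%:R) / 48)) <= 1 / 2 * (eta * eta).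
  rewrite -e2 -exprS; apply: le_trans (expR_natN_le _ _); rewrite ler_expR.
  have : 100 * T%:R + 48 <= Q%:R :> R by rewrite -natrM -natrD ler_nat.
  rewrite -[(2 * T).+1]addn1 natrD natrM; lra.
have h2 : #|I|%:R * expR (- (m%:R / (4 * Q%:R))) <= 1 / 4 * (eta * eta).
  apply: (@le_trans _ _ (expR (- (2 * T + 2)%:R))).
    rewrite -[m%:R / _](subrK (2 * T + 2)%:R) opprD expRD mulrA -[leRHS]mul1r.
    rewrite ler_wpM2r ?expR_ge0// expRN ler_pdivrMr ?expR_gt0// mul1r.
    apply: le_trans B_le; rewrite ler_nat; apply: leq_trans I_le.
    by rewrite -[leqLHS]muln1 leq_mul2l expn_gt0 m_gt0 orbT.
  apply: (le_trans (expR_natN_le R _)); rewrite exprD e2 mulrC -/eta.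
  by rewrite ler_wpM2r ?mulr_ge0 ?eta_ge0//; lra.
move: h1 h2; set e := expR _; set e' := expR _; nra.
Qed.

(** Three cases: many heavy segments; one factor of large mass on the light segments; or all factors
    thinly spread there. *)
Lemma product_step : depth_claim D ->
  prob R bad <= D.+1%:R * level + eta.
Proof.
move=> IH; have [I1_ge|I1_lt] := leqP (2 * T) #|I1|.
  by rewrite addrC (le_trans (prob_bad_le_good IH))// lerD2r prob_not_good_many.
have [/forallP N_ge|] :=
    boolP [forall j, \sum_(i in ~: I1) \sum_h w i j h <= N]%N.
  apply: (le_trans (prob_bad_spread I1_lt N_ge)).
  by rewrite lerDr; exact: mulr_ge0 (ler0n _ _) (mulr_ge0 (ler0n _ _) eta_ge0).
rewrite negb_forall => /existsP[j]; rewrite -ltnNge => N_lt.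
by rewrite addrC (le_trans (prob_bad_le_good IH))// lerD2r (prob_not_good_mass N_lt).
Qed.

End ProductStep.

(** * Products of affine factors *)

Section BaseFactors.

Variable R : realType.

(** The value of [factor_bound] at depth 0 as a function of the number [n] of survivors. *)
Definition base_bound (n : nat) : R :=
  Num.min (if odd n then 3 / 4 else 1) (2 * (3 / 4) ^+ n).

Lemma base_bound_ge0 n : 0 <= base_bound n.
Proof.
rewrite le_min; apply/andP; split; first by case: ifP => _; lra.
by rewrite mulr_ge0// exprn_ge0// divr_ge0.
Qed.

Lemma base_bound_le1 n : base_bound n <= 1.
Proof. by rewrite ge_min; case: ifP => _; apply/orP; left; lra. Qed.

Lemma base_bound_le n : odd n || (4 <= n)%N -> base_bound n <= 3 / 4.
Proof.
move=> /orP[odd_n|n4]; first by rewrite /base_bound odd_n ge_min lexx.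
rewrite ge_min; apply/orP; right.
apply: (@le_trans _ _ (2 * (3 / 4) ^+ 4)); last by rewrite !exprS expr0; lra.
by rewrite ler_wpM2l//; apply: ler_wiXn2l => //; lra.
Qed.

(** A single favourable coin, of probability [1 / #|T|], lowers the average by a quarter of its
    probability. *)
Lemma Ex_le_gap (T : finType) (f : T -> R) :
  (forall t, f t <= 1) -> (exists t, f t <= 3 / 4) ->
  Ex f <= 1 - 1 / (4 * #|T|%:R).
Proof.
move=> f1 [t ft]; have T0 : 0 < #|T|%:R :> R by rewrite ltr0n; apply/card_gt0P; exists t.
rewrite /Ex ler_pdivrMr//.
have -> : (1 - 1 / (4 * #|T|%:R)) * #|T|%:R = #|T|%:R - 1 / 4 :> R.
  by field; rewrite gt_eqF.
have -> : #|T|%:R = \sum_(t : T) 1 :> R by rewrite sumr_const.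
rewrite (bigD1 t)//= [in leRHS](bigD1 t)//=.
have : \sum_(t' | t' != t) f t' <= \sum_(t' | t' != t) 1 by apply: ler_sum.
lra.
Qed.

Variable m : nat.

Lemma card_seg_coins0 : #|seg_coins m 0| = 192%N.
Proof. by rewrite !card_prod !card_ord card_unit. Qed.

(** [768 = 4 * 192], where 192 is the number of coins of a depth 0 segment. *)
Definition base_decay : R := 1 - 1 / 768.

Lemma base_decayE : base_decay = 1 - 1 / (4 * #|seg_coins m 0|%:R).
Proof. by rewrite card_seg_coins0 /base_decay -natrM. Qed.

Lemma exists_coin_hit (U : {set xseg m 0}) : U != set0 ->
  exists c : seg_coins m 0, (0 < #|survivors c :&: U|)%N.
Proof.
move=> /set0Pn[[h x] xU]; exists (third_option, tt, (x, x)).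
by rewrite card_survivors_E3; case: (half_cases h) xU => -> ->; rewrite ?addn1.
Qed.

(** If [U] contains a whole half, a copy of [rho0] on it leaves four survivors in [U]. Otherwise,
    under [E_3], moving the edge of half [h] between a point inside [U] and one outside changes the
    parity. The offset [k] stands for the survivors elsewhere. *)
Lemma exists_coin_unbalanced (U : {set xseg m 0}) k : U != set0 ->
  exists c : seg_coins m 0,
    let n := (k + #|survivors c :&: U|)%N in odd n || (4 <= n)%N.
Proof.
move=> /set0Pn[[h x] xU].
have [/existsP[h' /forallP full]|] := boolP [exists h', [forall y, (h', y) \in U]].
  have [e [e2 he]] : exists e : 'I_3, (val e < 2)%N /\ half_of e = h'.
    case: (half_cases h') => ->; first by exists ord0.
    by exists (lift ord0 ord0).
  exists (e, tt, (x, x)); apply/orP; right.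
  apply: (@leq_trans #|survivors ((e, tt, (x, x)) : seg_coins m 0) :&: U|);
    last exact: leq_addl.
  pose F (i : 'I_4) : xseg m 0 := (h', (i, fst_half)).
  have <- : #|[set F i | i : 'I_4]| = 4%N.
    by rewrite card_imset ?card_ord// => i i' [].
  apply/subset_leq_card/subsetP => _ /imsetP[i _ ->].
  by rewrite in_setI survivors_E12_0// he !eqxx; apply: full.
rewrite negb_exists => /forallP/(_ h); rewrite negb_forall => /existsP[y yU].
pose coin z : seg_coins m 0 := (third_option, tt,
  if h == fst_half then (z, x) else (x, z)).
have cnt : exists b, forall z, #|survivors (coin z) :&: U| = (((h, z) \in U) + b)%N.
  rewrite /coin; case: (half_cases h) => ->; rewrite ?eqxx/=.
    by exists ((snd_half, x) \in U) => z; rewrite card_survivors_E3.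
  by exists ((fst_half, x) \in U) => z; rewrite card_survivors_E3 addnC.
case: cnt => b cnt; have [ob|ob] := boolP (odd (k + b)).
  by exists (coin y); rewrite /= cnt (negPf yU) ob.
by exists (coin x); rewrite /= cnt xU addnCA /= ob.
Qed.

End BaseFactors.

Section BaseProduct.

Variables (R : realType) (m : nat) (I J : finType).
Variables (tr : I -> J -> {set xseg m 0}) (n0 : J -> nat).
Hypothesis tr_disjoint : forall i j j', j != j' -> [disjoint tr i j & tr i j'].

Let n (c : {ffun I -> seg_coins m 0}) j : nat :=
  (n0 j + \sum_i #|survivors (c i) :&: tr i j|)%N.
Let psi c j : R := base_bound R (n c j).
Let touch i j := tr i j != set0.
Let rate : R := base_decay R.

(** Uses the bound [2 * (3 / 4) ^ n], which factors over the segments: each touched segment has a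
    coin with a survivor in it. *)
Lemma base_product_touch_many j :
  Ex (fun c => psi c j) <= 2 * rate ^+ #|[set i | touch i j]|.
Proof.
pose f i (c : seg_coins m 0) : R := (3 / 4) ^+ #|survivors c :&: tr i j|.
have f1 i c : f i c <= 1 by apply: exprn_ile1; lra.
have f0 i c : 0 <= f i c by rewrite exprn_ge0// divr_ge0.
apply: (@le_trans _ _ (Ex (fun c : {ffun I -> seg_coins m 0} => 2 * \prod_i f i (c i)))).
  apply: ler_Ex => c; rewrite ge_min; apply/orP; right; rewrite ler_wpM2l//.
  rewrite exprD prodrXr -[leRHS]mul1r ler_wpM2r ?exprn_ge0 ?divr_ge0//.
  by apply: exprn_ile1; lra.
rewrite ExZl Ex_prod ler_wpM2l// (bigID (fun i => i \in [set i | touch i j])) /=.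
rewrite -[leRHS]mulr1 -prodr_const; apply: ler_pM.
- by apply: prodr_ge0 => i _; exact: Ex_ge0.
- by apply: prodr_ge0 => i _; exact: Ex_ge0.
- apply: ler_prod => i; rewrite inE => tij; rewrite Ex_ge0//=.
  rewrite /rate (base_decayE R m); apply: Ex_le_gap => //.
  have [c hit] := exists_coin_hit tij; exists c.
  by rewrite /f -[leRHS]expr1; apply: ler_wiXn2l => //; lra.
- by apply: prodr_ile1 => i _; rewrite Ex_ge0//=; exact: Ex_le_cst.
Qed.

(* Pairs [(i, j)] with [j] touching segment [i], where the segment of a pair is
   touched by none of the factors of the later pairs: the coins of the segments
   can then be integrated out one after the other. *)
Definition triangular (s : seq (I * J)) : bool :=
  all (fun p => touch p.1 p.2) s
  && pairwise (fun p p' => ~~ touch p.1 p'.2) s.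

Lemma triangular_uniq s : triangular s -> uniq [seq p.2 | p <- s].
Proof.
elim: s => //= p s IH /andP[/andP[tp ts] /andP[ps pws]].
rewrite (IH (introT andP (conj ts pws))) andbT.
apply/negP => /mapP[p' p's E]; move: (allP ps _ p's).
by rewrite -E tp.
Qed.

(** The segment of the first pair is integrated out. The later factors do not touch it, and its own
    factor gains [rate] whatever the other coins are. *)
Lemma Ex_triangular s : (0 < m)%N -> triangular s ->
  Ex (fun c => \prod_(p <- s) psi c p.2) <= rate ^+ size s.
Proof.
move=> m0; elim: s => [|[i j] s IH] /=.
  by move=> _; apply: Ex_le_cst => // c; rewrite big_nil.
move=> /andP[/andP[tij ts] /andP[ps pws]].
have psi0 c j' : 0 <= psi c j' by exact: base_bound_ge0.
have rate0 : 0 <= rate by rewrite /rate /base_decay; lra.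
rewrite (Ex_upd i _ (seg_coins_gt0 0 m0)) exprS mulrC.
apply: le_trans (ler_wpM2r rate0 (IH (introT andP (conj ts pws)))).
rewrite -ExZr; apply: ler_Ex => c.
have rest x : \prod_(p <- s) psi (upd c i x) p.2 = \prod_(p <- s) psi c p.2.
  apply: eq_big_seq => p /(allP ps) /negPn /eqP /= tr0.
  rewrite /psi /n; congr (base_bound _ (_ + _)); apply: eq_bigr => i' _.
  by rewrite ffunE; case: eqP => // ->; rewrite tr0 !setI0.
rewrite (eq_Ex (g := fun x => \prod_(p <- s) psi c p.2 * psi (upd c i x) j)); last first.
  by move=> x; rewrite big_cons rest mulrC.
rewrite ExZl ler_wpM2l ?prodr_ge0//.
rewrite /rate (base_decayE R m); apply: Ex_le_gap => [x|].
  exact: base_bound_le1.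
have [x hx] := exists_coin_unbalanced
  (n0 j + \sum_(i' | i' != i) #|survivors (c i') :&: tr i' j|) tij.
exists x; apply: base_bound_le; rewrite /n.
rewrite (bigD1 i)//= ffunE eqxx addnCA addnC -addnA.
rewrite (eq_bigr (fun i' => #|survivors (c i') :&: tr i' j|)).
  by rewrite addnA.
by move=> i' /negPf ii'; rewrite ffunE ii'.
Qed.

(** Greedy choice: take a segment of [A] and a factor touching it, delete the at most [K] segments
    that this factor touches, and repeat. *)
Lemma exists_triangular (K k : nat) (A : {set I}) : (0 < K)%N ->
  (forall j, #|[set i | touch i j]| <= K)%N ->
  (forall i, i \in A -> exists j, touch i j) -> (k * K <= #|A|)%N ->
  exists s, [/\ triangular s, size s = k & all (fun p => p.1 \in A) s].
Proof.
move=> K0 deg; elim: k A => [|k IH] A A_touched kK; first by exists [::].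
have /card_gt0P[i iA] : (0 < #|A|)%N by apply: leq_trans kK; rewrite muln_gt0.
have [j tij] := A_touched i iA.
have [||s [ts ss sA]] := IH (A :\: [set i | touch i j]).
- by move=> i' /setDP[/A_touched].
- apply: (@leq_trans (#|A| - K)).
    by rewrite leq_subRL ?(leq_trans _ kK)// mulSn ?leq_addr.
  by rewrite cardsD leq_sub2l// (leq_trans (subset_leq_card (subsetIr _ _)))// deg.
(* The new pair goes last: the segments in [s] were chosen among those that [j] does not touch. *)
exists (rcons s (i, j)); rewrite size_rcons ss all_rcons /= iA /=; split=> //.
  rewrite /triangular all_rcons /= tij; move/andP: ts => [-> pws] /=.
  rewrite pairwise_rcons pws andbT; apply/allP => p /(allP sA).
  by rewrite !inE => /andP[].
by apply: sub_all sA => p; rewrite inE => /andP[].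
Qed.

End BaseProduct.

(** * Induction on the depth *)

Section DepthInduction.

Variables (R : realType) (F : fieldType) (V : finType) (m T L Q B s : nat).

Local Notation eta := ((1 / 2) ^+ T : R).

Hypothesis m_gt0 : (0 < m)%N.
Hypothesis s_gt0 : (0 < s)%N.
Hypothesis B_gt0 : (0 < B)%N.
Hypothesis L_def : L = (768 * (2 * T + 1))%N.
Hypothesis Q_ge : (2 * L ^ 2 <= Q)%N.
Hypothesis B_le : B%:R <= expR (m%:R / (4 * Q%:R) - (2 * T + 2)%:R) :> R.

(** [(1 - 1 / 768) ^ 768 <= exp (-1) <= 1 / 2]. Hence [L] decay steps give [eta * eta / 2]. *)
Lemma base_decay_pow k : base_decay R ^+ (768 * k) <= (1 / 2) ^+ k.
Proof.
rewrite exprM; apply: lerXn2r; rewrite ?nnegrE ?exprn_ge0 ?divr_ge0//.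
  by rewrite /base_decay; lra.
apply: (@le_trans _ _ (expR (- 1%:R))); last exact: (expR_natN_le R 1).
have -> : - 1%:R = 768%:R * (- (1 / 768)) :> R by lra.
rewrite expRM_natl lerXn2r ?nnegrE ?expR_ge0//; first by rewrite /base_decay; lra.
exact: expR_ge1Dx.
Qed.

(** If a factor touches more than [L] segments, it suffices alone. Otherwise [L * L] touched
    segments yield a triangular sequence of length [L]. Both cases end with Markov at the threshold
    [eta]. *)
Lemma base_product_step (I J : finType) (I0 : {set I}) (iota : I -> xseg m 0 -> V)
    (Fix : {set V}) (g : J -> formula F V) :
  embeds_segments I0 iota -> avoids_segments I0 iota Fix ->
  (forall j j', j != j' -> [disjoint Vars (g j) & Vars (g j')]) ->
  (Q * #|xvar m 0| <= \sum_i \sum_j #|trace I0 iota (Vars (g j)) i|)%N ->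
  prob R (fun c => eta <= \prod_j factor_bound R 0 (alive I0 iota Fix c) (g j)) <= eta.
Proof.
move=> iota_inj Fix_off g_disjoint mass_ge.
have eta0 : 0 < eta by exact: eta_gt0.
have eta2 : (1 / 2) ^+ (2 * T) = eta * eta by rewrite mul2n -addnn exprD.
pose tr i j := trace I0 iota (Vars (g j)) i.
have tr_disjoint i j j' : j != j' -> [disjoint tr i j & tr i j'].
  by move=> /g_disjoint; apply: trace_disjoint.
pose psi c j := base_bound R
  (#|Vars (g j) :&: Fix| + \sum_i #|survivors (c i) :&: tr i j|).
have factorE c j : factor_bound R 0 (alive I0 iota Fix c) (g j) = psi c j.
  by rewrite /psi -card_alive.
pose bad c := eta <= \prod_j factor_bound R 0 (alive I0 iota Fix c) (g j).
rewrite -/bad; have psi0 c j : 0 <= psi c j by exact: base_bound_ge0.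
have psi1 c j : psi c j <= 1 by exact: base_bound_le1.
have L0 : (0 < L)%N by rewrite L_def muln_gt0 addn1.
have decay : base_decay R ^+ L <= 1 / 2 * (eta * eta).
  rewrite L_def; apply: (le_trans (base_decay_pow _)).
  by rewrite addn1 exprS eta2.
have [/forallP deg|] := boolP [forall j, #|[set i | tr i j != set0]| <= L]%N; last first.
  rewrite negb_forall => /existsP[j]; rewrite -ltnNge => many.
  have psi_ge c : bad c -> eta <= psi c j.
    move=> h; apply: (le_trans h); rewrite (bigD1 j)//= factorE -[leRHS]mulr1.
    rewrite ler_wpM2l//; apply: prodr_ile1 => j' _.
    by rewrite factor_bound_ge0 factor_bound_le1.
  apply: (le_trans (@markov R _ eta bad _ eta0 (fun c => psi0 c j) psi_ge)).
  rewrite ler_pdivrMr//; apply: (le_trans (@base_product_touch_many R m I J tr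
    (fun j => #|Vars (g j) :&: Fix|) j)).
  have : base_decay R ^+ #|[set i | tr i j != set0]| <= base_decay R ^+ L.
    by apply: ler_wiXn2l; rewrite ?(ltnW many)// /base_decay; lra.
  move=> /le_trans/(_ decay) le_decay; have -> : eta * eta = 2 * (1 / 2 * (eta * eta)).
    by field.
  by rewrite ler_wpM2l.
pose A : {set I} := [set i | [exists j, tr i j != set0]].
(* A segment has 16 variables, and the mass is at least [8 * Q >= 16 * L ^ 2]. *)
have A_ge : (L * L <= #|A|)%N.
  have : (\sum_i \sum_j #|tr i j| <= 16 * #|A|)%N.
    rewrite mulnC -sum_nat_const [leqRHS]big_mkcond /=; apply: leq_sum => i _.
    have [iA|] := boolP (i \in A); last first.
      rewrite inE negb_exists => /forallP tr0; rewrite big1 // => j _.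
      by move: (tr0 j); rewrite negbK => /eqP->; rewrite cards0.
    rewrite -(@card_bigcup_disjoint _ _ predT (tr i)); last exact: tr_disjoint.
    by apply: (leq_trans (max_card _)); rewrite /= !card_prod !card_ord.
  move: mass_ge; rewrite /= card_prod !card_ord => mass_ge le16.
  have := leq_trans mass_ge le16; move: Q_ge; rewrite -mulnn; lia.
have [|sq [tri size_sq _]] := exists_triangular L0 deg _ A_ge.
  by move=> i; rewrite inE => /existsP.
pose sub c := \prod_(p <- sq) psi c p.2.
have sub0 c : 0 <= sub c by apply: prodr_ge0.
have sub_ge c : bad c -> eta <= sub c.
  move=> h; apply: (le_trans h); under eq_bigr do rewrite factorE.
  (* The factors outside the sequence are at most 1; those in it are distinct by
     [triangular_uniq]. *)
  rewrite /sub -(big_map snd predT (psi c)) (bigID (mem [seq p.2 | p <- sq])) /=.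
  rewrite [in leRHS]big_uniq /=; last exact: triangular_uniq tri.
  rewrite -[leRHS]mulr1 ler_wpM2l ?prodr_ge0//.
  by apply: prodr_ile1 => j _; rewrite psi0 psi1.
apply: (le_trans (@markov R _ eta bad _ eta0 sub0 sub_ge)).
rewrite ler_pdivrMr//.
have := @Ex_triangular R m I J tr (fun j => #|Vars (g j) :&: Fix|) sq m_gt0 tri.
rewrite size_sq -/sub => Ex_sub; apply: (le_trans Ex_sub).
by apply: (le_trans decay); rewrite ler_piMl ?mulr_ge0 ?ltW//; lra.
Qed.

Lemma leq_nth_sumn (l : seq nat) i : (nth 0 l i <= sumn l)%N.
Proof.
elim: l i => [|x l IH] [|i] //=; first exact: leq_addr.
exact: leq_trans (IH i) (leq_addl _ _).
Qed.

Lemma fsize_gt0 (f : formula F V) : (0 < fsize f)%N. Proof. by case: f. Qed.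

Section Gates.

Variables (D : nat) (I : finType) (I0 : {set I}) (iota : I -> xseg m D -> V).
Variable Fix : {set V}.
Hypothesis iota_inj : embeds_segments I0 iota.
Hypothesis Fix_off : avoids_segments I0 iota Fix.
Hypothesis I_le : (#|I| * m ^ D <= B)%N.

Let level k : R := (s ^ k)%:R * eta.
Let al (c : {ffun I -> seg_coins m D}) := alive I0 iota Fix c.

Lemma product_family (J : finType) (g : J -> formula F V) :
  (forall D', D = D'.+1 -> depth_claim R F V m T Q B s D') ->
  (forall j j', j != j' -> [disjoint Vars (g j) & Vars (g j')]) ->
  (forall j, SigmaPiSigma D (g j)) -> (forall j, variable_labelled (g j)) ->
  (forall j, (fsize (g j) <= s)%N) ->
  (Q * #|xvar m D| <= \sum_i \sum_j #|trace I0 iota (Vars (g j)) i|)%N ->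
  prob R (fun c => level D <= \prod_j factor_bound R D (al c) (g j))
    <= D%:R * level D + eta.
Proof.
have Q_ge' : (100 * T + 48 <= Q)%N by apply: leq_trans Q_ge; rewrite L_def; lia.
rewrite /al /level; clear al level.
case: D iota iota_inj Fix_off I_le => [|D'] iota' inj off I_le' IH gdis gdep gvl gsz mass.
  have -> : (s ^ 0)%:R * eta = eta by rewrite [LHS]mul1r.
  rewrite mul0r add0r; exact: (base_product_step inj off gdis mass).
by apply: (@product_step R F V m T Q B s) => //; apply: IH.
Qed.

Lemma product_gate A (t : seq (formula F V)) :
  (forall D', D = D'.+1 -> depth_claim R F V m T Q B s D') ->
  variable_labelled (Prod A t) -> all (@SigmaPiSigma F V D) t ->
  (fsize (Prod A t) <= s)%N ->
  (Q * #|xvar m D| <= \sum_i #|trace I0 iota A i|)%N ->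
  prob R (fun c => level D <= \prod_(g <- t) factor_bound R D (al c) g)
    <= D%:R * level D + eta.
Proof.
move=> IH /= /andP[_ /and3P[t_disjoint /eqP A_def t_vl]] t_depth t_size mass_ge.
pose g0 : formula F V := Const set0 0.
pose g (j : 'I_(size t)) := nth g0 t j.
have prodE c : \prod_(h <- t) factor_bound R D (al c) h
    = \prod_j factor_bound R D (al c) (g j).
  by rewrite (big_nth g0) big_mkord.
have g_disjoint j j' : j != j' -> [disjoint Vars (g j) & Vars (g j')].
  move: t_disjoint => /(pairwiseP g0) t_disjoint.
  rewrite -(inj_eq val_inj) neq_ltn => /orP[lt_jj'|lt_j'j].
    by apply: t_disjoint; rewrite ?inE.
  by rewrite disjoint_sym; apply: t_disjoint; rewrite ?inE.
rewrite prob_Ex; under eq_Ex do rewrite prodE; rewrite -prob_Ex.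
apply: product_family => // [j|j|j|].
- exact: all_nthP t_depth _ _.
- exact: all_nthP t_vl _ _.
- apply: leq_trans t_size; apply/leqW.
  apply: leq_trans (leq_nth_sumn [seq fsize h | h <- t] j).
  by rewrite (nth_map g0).
apply: (leq_trans mass_ge); apply: leq_sum => i _.
have -> : A = \bigcup_j Vars (g j).
  by rewrite -A_def big_map (big_nth g0) big_mkord.
rewrite trace_bigcup card_bigcup_disjoint// => j j' jj'.
by apply: trace_disjoint; apply: g_disjoint.
Qed.

(** If all terms stay below [level D], their sum stays below [s * level D]. A union bound over the
    terms then multiplies the error of [product_gate] by at most [s]. *)
Lemma sum_gate A (cs : seq (F * formula F V)) :
  (forall D', D = D'.+1 -> depth_claim R F V m T Q B s D') ->
  variable_labelled (Sum A cs) -> SigmaPiSigma D.+1 (Sum A cs) ->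
  (fsize (Sum A cs) <= s)%N ->
  (Q * #|xvar m D| <= \sum_i #|trace I0 iota A i|)%N ->
  prob R (fun c => level D.+1 <= rank_bound R D.+1 (al c) (Sum A cs))
    <= D.+1%:R * level D.+1.
Proof.
move=> IH /andP[_ /andP[cs_vars cs_vl]] cs_depth cs_size mass_ge.
pose p0 : F * formula F V := (0, Const set0 0).
pose term (k : 'I_(size cs)) c : R := if (nth p0 cs k).2 is Prod _ t then
  \prod_(g <- t) factor_bound R D (al c) g else 0.
have rankE c : rank_bound R D.+1 (al c) (Sum A cs) = \sum_k term k c.
  by rewrite /= (big_nth p0) big_mkord.
have eta0 : 0 < eta by exact: eta_gt0.
have level0 k : 0 < level k by rewrite mulr_gt0// ltr0n expn_gt0 s_gt0.
have levelS : level D.+1 = s%:R * level D by rewrite /level expnS natrM mulrA.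
(* Strict, since the sum gate itself is counted in [fsize]. *)
have size_lt : (size cs < s)%N.
  apply: leq_trans cs_size => /=; rewrite ltnS.
  elim: (cs) => //= p l IHl; apply: (leq_add (fsize_gt0 p.2) IHl).
apply: (@le_trans _ _ (prob R (fun c => [exists k, level D <= term k c]))).
  apply: prob_le => c; rewrite rankE; apply: contraLR; rewrite negb_exists.
  move=> /forallP term_lt; rewrite -ltNge levelS.
  apply: (@le_lt_trans _ _ ((size cs)%:R * level D)); last by rewrite ltr_pM2r// ltr_nat.
  rewrite -[in leRHS](card_ord (size cs)) mulr_natl -sumr_const.
  by apply: ler_sum => k _; move: (term_lt k); rewrite -ltNge => /ltW.
apply: (@le_trans _ _ (#|'I_(size cs)|%:R * (D%:R * level D + eta))).
  apply: prob_exists => k; rewrite /term.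
  have := all_nthP p0 cs_depth k (ltn_ord k).
  have := all_nthP p0 cs_vl k (ltn_ord k).
  have /eqP := all_nthP p0 cs_vars k (ltn_ord k).
  have : (fsize (nth p0 cs k).2 <= s)%N.
    apply: leq_trans cs_size; apply/leqW.
    apply: leq_trans (leq_nth_sumn [seq fsize c.2 | c <- cs] k).
    by rewrite (nth_map p0).
  case: (nth p0 cs k).2 => //= A' t t_size A'A t_vl t_depth.
  by apply: product_gate t_vl t_depth t_size _; rewrite // A'A.
rewrite card_ord levelS [leRHS]mulrCA; apply: ler_pM; first exact: ler0n.
- apply: addr_ge0; last exact: ltW.
  by apply: mulr_ge0; [exact: ler0n|apply: ltW; exact: level0].
- by rewrite ler_nat ltnW.
rewrite -[D.+1%:R]natr1 mulrDl lerD2l [leRHS]mul1r.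
exact: eta_le_pow.
Qed.

End Gates.

Lemma depth_claim_holds D : depth_claim R F V m T Q B s D.
Proof.
have step D' : (forall D0, D' = D0.+1 -> depth_claim R F V m T Q B s D0) ->
    depth_claim R F V m T Q B s D'.
  move=> IH I I0 iota Fix [] // A cs inj off depth_f vl_f size_f I_le mass.
  exact: sum_gate.
by elim: D => [|D IH]; apply: step => // D0 [<-].
Qed.

End DepthInduction.

(** * Ranks of coefficient matrices *)

Section CoefficientRank.

Variables (F : fieldType) (V : finType).
Implicit Types (p : {mpoly F[#|V|]}) (A B U S T : {set V}).

(* Rank at most [r], in a form that is stable under products of polynomials in
   disjoint sets of variables. *)
Definition factorizes A B p (r : nat) : Prop :=
  exists (K : finType) (u w : K -> {set V} -> F), (#|K| <= r)%N /\
    forall S T, S \subset A -> T \subset B ->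
      p@_(monomial (S :|: T)) = \sum_k u k S * w k T.

Lemma factorizes_rank A B p r :
  factorizes A B p r -> (\rank (coef_matrix A B p) <= r)%N.
Proof.
case=> K [u [w [Kr puw]]].
pose M1 : 'M[F]_(#|powerset A|, #|K|) := \matrix_(i, k) u (enum_val k) (enum_val i).
pose M2 : 'M[F]_(#|K|, #|powerset B|) := \matrix_(k, j) w (enum_val k) (enum_val j).
have -> : coef_matrix A B p = M1 *m M2.
  apply/matrixP => i j; rewrite !mxE.
  have := enum_valP i; have := enum_valP j; rewrite !inE => jB iA.
  rewrite puw// (reindex (@enum_val K predT)) /=; last first.
    by apply/onW_bij; exact: enum_val_bij.
  by apply: eq_big => [k|k _]; rewrite ?inE ?mxE.
by apply: leq_trans Kr; apply: (leq_trans (mxrankM_maxl _ _)); apply: rank_leq_col.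
Qed.

Lemma rank_factorizes A B p : factorizes A B p (\rank (coef_matrix A B p)).
Proof.
set M := coef_matrix A B p.
have A0 : set0 \in powerset A by rewrite inE sub0set.
have B0 : set0 \in powerset B by rewrite inE sub0set.
exists 'I_(\rank M), (fun k S => col_base M (enum_rank_in A0 S) k),
  (fun k T => row_base M k (enum_rank_in B0 T)); rewrite card_ord; split=> // S T SA TB.
have := mulmx_base M => /matrixP/(_ (enum_rank_in A0 S) (enum_rank_in B0 T)).
by rewrite [in RHS]mxE !enum_rankK_in ?inE// => <-; rewrite mxE.
Qed.

Lemma rank_coef_matrix_leq A B p :
  (\rank (coef_matrix A B p) <= 2 ^ minn #|A| #|B|)%N.
Proof.
by rewrite /minn; case: ifP => _; rewrite -card_powerset ?rank_leq_row ?rank_leq_col.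
Qed.

Definition uses U p : Prop :=
  forall (mm : 'X_{1..#|V|}) i, p@_mm != 0 -> mm i != 0%N -> enum_val i \in U.

Definition affine p : Prop := forall mm : 'X_{1..#|V|}, p@_mm != 0 -> (mdeg mm <= 1)%N.

Lemma mcoeffM_neq0 p q (mm : 'X_{1..#|V|}) : (p * q)@_mm != 0 ->
  exists k1 k2 : 'X_{1..#|V|}, [/\ mm = (k1 + k2)%MM, p@_k1 != 0 & q@_k2 != 0].
Proof.
rewrite -mcoeff_msupp => /msuppM_le/allpairsP[[k1 k2] /= [k1p k2q ->]].
by exists k1, k2; rewrite -!mcoeff_msupp.
Qed.

Lemma uses_mul U U' p q : uses U p -> uses U' q -> uses (U :|: U') (p * q).
Proof.
move=> pU qU' mm i /mcoeffM_neq0[k1 [k2 [-> pk qk]]].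
rewrite mnmDE addn_eq0 negb_and inE => /orP[k1i|k2i]; first by rewrite (pU _ _ pk).
by rewrite (qU' _ _ qk)// orbT.
Qed.

Lemma uses0 U : uses U 0. Proof. by move=> mm i; rewrite mcoeff0 eqxx. Qed.

Lemma usesD U p q : uses U p -> uses U q -> uses U (p + q).
Proof.
move=> pU qU mm i; rewrite mcoeffD => pq0 mi.
have [p0|] := eqVneq p@_mm 0; last by move/pU; apply.
by apply: (qU mm) => //; apply: contraNneq pq0 => q0; rewrite p0 q0 addr0.
Qed.

Lemma usesZ U a p : uses U p -> uses U (a *: p).
Proof.
move=> pU mm i; rewrite mcoeffZ mulf_eq0 negb_or => /andP[_ p0] mi.
exact: (pU mm).
Qed.

Lemma usesC U a : uses U a%:MP.
Proof.
move=> mm i; rewrite mcoeffC; case: (mm =P 0%MM) => [->|_].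
  by rewrite mnm0E.
by rewrite mulr0 eqxx.
Qed.

Lemma uses_mvar U v : v \in U -> uses U (mvar F v).
Proof.
move=> vU mm i; rewrite mcoeffX; case: (_ =P mm) => [<-|_]; last by rewrite eqxx.
by rewrite mnm1E; case: (_ =P i) => [<-|//] _ _; rewrite enum_rankK.
Qed.

Lemma affine0 : affine 0. Proof. by move=> mm; rewrite mcoeff0 eqxx. Qed.

Lemma affineD p q : affine p -> affine q -> affine (p + q).
Proof.
move=> pU qU mm; rewrite mcoeffD => pq0.
have [p0|] := eqVneq p@_mm 0; last exact: pU.
by apply: qU; apply: contraNneq pq0 => q0; rewrite p0 q0 addr0.
Qed.

Lemma affineZ a p : affine p -> affine (a *: p).
Proof.
by move=> pU mm; rewrite mcoeffZ mulf_eq0 negb_or => /andP[_ p0]; exact: pU.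
Qed.

Lemma affineC a : affine a%:MP.
Proof.
move=> mm; rewrite mcoeffC; case: (mm =P 0%MM) => [->|_]; first by rewrite mdeg0.
by rewrite mulr0 eqxx.
Qed.

Lemma affine_mvar v : affine (mvar F v).
Proof.
by move=> mm; rewrite mcoeffX; case: (_ =P mm) => [<-|_]; rewrite ?mdeg1// eqxx.
Qed.

Lemma mdeg_monomial S : mdeg (monomial S) = #|S|.
Proof.
rewrite mdegE -sum1_card (reindex (@enum_val V predT)) /=; last first.
  by apply/onW_bij; exact: enum_val_bij.
rewrite [RHS]big_mkcond /=; apply: eq_bigr => i _; rewrite mnmE.
by case: (enum_val i \in S).
Qed.

(** The matrix vanishes outside the row and the column of the empty set. The index [true] carries
    that column and [false] the row without the common corner. *)
Lemma affine_factorizes A B p : [disjoint A & B] -> affine p -> factorizes A B p 2.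
Proof.
move=> AB p_affine; exists bool,
  (fun b S => if b then p@_(monomial S) else (S == set0)%:R),
  (fun b T => if b then (T == set0)%:R else if T == set0 then 0 else p@_(monomial T)).
rewrite card_bool; split=> // S T SA TB; rewrite big_bool /=.
have [->|T0] := eqVneq T set0; first by rewrite setU0 mulr1 mulr0 addr0.
have [->|S0] := eqVneq S set0; first by rewrite set0U mulr0 add0r mul1r.
rewrite mulr0 mul0r addr0; apply/eqP; apply: contraTT isT => /p_affine.
rewrite mdeg_monomial cardsU.
have -> : S :&: T = set0.
  by apply/eqP; rewrite setI_eq0; apply: disjointWl SA (disjointWr TB AB).
by rewrite cards0 subn0; rewrite -!card_gt0 in S0 T0; lia.
Qed.

Lemma mcoeff_disjointM U U' p q (X : {set V}) :
  [disjoint U & U'] -> uses U p -> uses U' q -> X \subset U :|: U' ->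
  (p * q)@_(monomial X) = p@_(monomial (X :&: U)) * q@_(monomial (X :&: U')).
Proof.
move=> UU' pU qU' XUU'.
have UU'E v : v \in U -> v \in U' = false by move=> vU; exact: (disjointFr UU').
have XE : monomial X = (monomial (X :&: U) + monomial (X :&: U'))%MM.
  apply/mnmP => i; rewrite mnmDE !mnmE !inE.
  have := subsetP XUU' (enum_val i); rewrite inE.
  case: (enum_val i \in X) => //= /(_ isT).
  have [vU _|vU /= ->//] := boolP (enum_val i \in U); by rewrite (UU'E _ vU).
have bnd (Y : {set V}) : (mdeg (monomial (X :&: Y)) < (mdeg (monomial X)).+1)%N.
  by rewrite !mdeg_monomial ltnS subset_leq_card// subsetIl.
rewrite mcoeffM (bigD1 (BMultinom (bnd U), BMultinom (bnd U'))) /=; last by rewrite -XE.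
(* In any other splitting of the monomial one of the two coefficients is zero. *)
rewrite big1 ?addr0// => -[[k1 b1] [k2 b2]] /= /andP[/eqP XE' neq].
apply: contraNeq neq; rewrite mulf_eq0 negb_or => /andP[pk1 qk2].
have kU i : k1 i != 0%N -> enum_val i \in U by apply: pU.
have kU' i : k2 i != 0%N -> enum_val i \in U' by apply: qU'.
have k1E : k1 = monomial (X :&: U).
  apply/mnmP => i; move/mnmP/(_ i): XE'; rewrite mnmDE !mnmE !inE.
  have [vU|vU] := boolP (enum_val i \in U); rewrite ?andbT ?andbF.
    have -> : k2 i = 0%N by apply: contraFeq (UU'E _ vU) => /kU'.
    by rewrite addn0.
  by move=> _; apply: contraNeq vU; apply: kU.
have k2E : k2 = monomial (X :&: U').
  apply/mnmP => i; move/mnmP/(_ i): XE'; rewrite mnmDE !mnmE !inE.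
  have [vU|vU] := boolP (enum_val i \in U'); rewrite ?andbT ?andbF.
    have -> : k1 i = 0%N by apply: contraTeq vU => /kU/UU'E ->.
    by rewrite add0n.
  by move=> _; apply: contraNeq vU; apply: kU'.
by rewrite xpair_eqE -!val_eqE /= k1E k2E !eqxx.
Qed.

(** The tensor product of two rank factorizations. *)
Lemma rank_mul A A' B B' p q :
  [disjoint A :|: B & A' :|: B'] -> uses (A :|: B) p -> uses (A' :|: B') q ->
  (\rank (coef_matrix (A :|: A') (B :|: B') (p * q))
   <= \rank (coef_matrix A B p) * \rank (coef_matrix A' B' q))%N.
Proof.
move=> dis pAB qAB'; apply: factorizes_rank.
have [K [u [w [Kr puw]]]] := rank_factorizes A B p.
have [K' [u' [w' [Kr' quw]]]] := rank_factorizes A' B' q.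
exists (K * K')%type, (fun k S => u k.1 (S :&: A) * u' k.2 (S :&: A')),
  (fun k T => w k.1 (T :&: B) * w' k.2 (T :&: B')).
split; first by rewrite card_prod leq_mul.
move=> S T SA TB; rewrite (mcoeff_disjointM dis pAB qAB'); last first.
  by rewrite setUACA; apply: setUSS.
have disE v : v \in A :|: B -> v \in A' :|: B' -> false.
  by move=> vAB; rewrite (disjointFr dis vAB).
have restr : (S :|: T) :&: (A :|: B) = (S :&: A) :|: (T :&: B).
  apply/setP => v; have := disE v; rewrite !inE.
  have := subsetP SA v; have := subsetP TB v; rewrite !inE.
  by case: (v \in S) (v \in T) (v \in A) (v \in B) (v \in A') (v \in B')
    => [] [] [] [] [] [] //= h1 h2 h3;
    by [have := h1 isT|have := h2 isT|have := h3 isT isT].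
have restr' : (S :|: T) :&: (A' :|: B') = (S :&: A') :|: (T :&: B').
  apply/setP => v; have := disE v; rewrite !inE.
  have := subsetP SA v; have := subsetP TB v; rewrite !inE.
  by case: (v \in S) (v \in T) (v \in A) (v \in B) (v \in A') (v \in B')
    => [] [] [] [] [] [] //= h1 h2 h3;
    by [have := h1 isT|have := h2 isT|have := h3 isT isT].
rewrite restr restr' puw ?subsetIr// quw ?subsetIr// big_distrlr /= pair_big /=.
by apply: eq_bigr => -[k k'] _; rewrite mulrACA.
Qed.

End CoefficientRank.

(** * Relative rank under sums, products and odd numbers of variables *)

Section RelativeRank.

Variables (R : realType) (F : fieldType) (V : finType).
Implicit Types (p : {mpoly F[#|V|]}) (A B : {set V}).

Local Notation rt := (2 `^ (1 / 2) : R).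

Lemma powR_half n : 2 `^ (n%:R / 2) = rt ^+ n.
Proof. by rewrite -powR_mulrn ?powR_ge0// -powRrM; congr (_ `^ _); field. Qed.

Lemma rt_gt0 : 0 < rt. Proof. exact: powR_gt0. Qed.

Lemma rt_sqr : rt ^+ 2 = 2.
Proof. by rewrite -powR_half divff ?pnatr_eq0// powRr1. Qed.

Lemma rtV_le : rt^-1 <= 3 / 4.
Proof.
rewrite -[leRHS]invrK lef_pV2 ?posrE ?rt_gt0 ?invr_gt0 ?divr_gt0//.
have := rt_sqr; have := rt_gt0; set x := rt; rewrite expr2; nra.
Qed.

Lemma relrkE A B p : relrk R A B p
  = (\rank (coef_matrix A B p))%:R * rt^-1 ^+ (#|A| + #|B|).
Proof. by rewrite /relrk powR_half exprVn. Qed.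

Lemma relrk_ge0 A B p : 0 <= relrk R A B p.
Proof. by rewrite relrkE mulr_ge0// exprn_ge0// invr_ge0 ltW// rt_gt0. Qed.

Lemma pow2_rt n : (2 ^ n)%:R = rt ^+ (n + n) :> R.
Proof. by rewrite natrX addnn -mul2n exprM rt_sqr. Qed.

(** A rank of at most [2 ^ a] uses up [a + a] of the factors [1 / sqrt 2]; each of [b] further ones
    is at most 3/4. *)
Lemma relrk_le_imbalance A B p (a b : nat) :
  (\rank (coef_matrix A B p) <= 2 ^ a)%N -> (a + a + b <= #|A| + #|B|)%N ->
  relrk R A B p <= (3 / 4) ^+ b.
Proof.
move=> rk_le ab; have r0 := rt_gt0; have rv0 : 0 <= rt^-1 by rewrite invr_ge0 ltW.
have rv1 : rt^-1 <= 1 by apply: (le_trans rtV_le); lra.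
rewrite relrkE; apply: (@le_trans _ _ ((2 ^ a)%:R * rt^-1 ^+ (a + a + b))).
  apply: ler_pM; rewrite ?exprn_ge0 ?ler_nat//.
  exact: ler_wiXn2l.
rewrite pow2_rt [_ ^+ (_ + b)]exprD mulrA -exprMn divff ?gt_eqF// expr1n [leLHS]mul1r.
by apply: lerXn2r; rewrite ?nnegrE ?divr_ge0 ?rtV_le.
Qed.

(** [2 * minn #|A| #|B|] falls short of an odd [#|A| + #|B|] by at least one. *)
Lemma relrk_le_parity A B p :
  relrk R A B p <= if odd (#|A| + #|B|) then 3 / 4 else 1.
Proof.
have rk_le := rank_coef_matrix_leq A B p.
have [oddAB|_] := boolP (odd _).
  by rewrite -[leRHS]expr1; apply: (relrk_le_imbalance rk_le); lia.
by rewrite -[leRHS](expr0 (3 / 4)); apply: (relrk_le_imbalance rk_le); lia.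
Qed.

Lemma relrk_affine A B p : [disjoint A & B] -> affine p ->
  relrk R A B p <= 2 * (3 / 4) ^+ (#|A| + #|B|).
Proof.
move=> AB p_aff; rewrite relrkE.
apply: ler_pM; rewrite ?exprn_ge0 ?invr_ge0 ?(ltW rt_gt0)//.
  by rewrite (ler_nat R _ 2) (factorizes_rank (affine_factorizes AB p_aff)).
by apply: lerXn2r; rewrite ?nnegrE ?invr_ge0 ?(ltW rt_gt0) ?divr_ge0 ?rtV_le.
Qed.

Lemma relrk_mul A A' B B' p q :
  [disjoint A & A'] -> [disjoint B & B'] ->
  [disjoint A :|: B & A' :|: B'] -> uses (A :|: B) p -> uses (A' :|: B') q ->
  relrk R (A :|: A') (B :|: B') (p * q) <= relrk R A B p * relrk R A' B' q.
Proof.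
move=> AA' BB' dis pAB qAB'; rewrite !relrkE.
rewrite !cardsU !(disjoint_setI0 _) // cards0 !subn0 addnACA exprD mulrACA -natrM.
rewrite ler_wpM2r ?mulr_ge0 ?exprn_ge0 ?invr_ge0 ?(ltW rt_gt0)//.
by rewrite ler_nat rank_mul.
Qed.

Lemma coef_matrixD A B p q : coef_matrix A B (p + q) = coef_matrix A B p + coef_matrix A B q.
Proof. by apply/matrixP => i j; rewrite !mxE mcoeffD. Qed.

Lemma coef_matrixZ A B a p : coef_matrix A B (a *: p) = a *: coef_matrix A B p.
Proof. by apply/matrixP => i j; rewrite !mxE mcoeffZ. Qed.

Lemma relrk0 A B : relrk R A B (0 : {mpoly F[#|V|]}) = 0.
Proof.
rewrite relrkE; have -> : coef_matrix A B (0 : {mpoly F[#|V|]}) = 0.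
  by apply/matrixP => i j; rewrite !mxE mcoeff0.
by rewrite mxrank0 mul0r.
Qed.

Lemma relrkD A B p q : relrk R A B (p + q) <= relrk R A B p + relrk R A B q.
Proof.
rewrite !relrkE -mulrDl -natrD coef_matrixD.
rewrite ler_wpM2r ?exprn_ge0 ?invr_ge0 ?(ltW rt_gt0)//.
by rewrite ler_nat mxrank_add.
Qed.

Lemma relrkZ A B a p : relrk R A B (a *: p) <= relrk R A B p.
Proof.
rewrite !relrkE coef_matrixZ ler_wpM2r ?exprn_ge0 ?invr_ge0 ?(ltW rt_gt0)//.
by rewrite ler_nat mxrankS// scalemx_sub.
Qed.

End RelativeRank.

(** * Relative rank of a restricted formula *)

Section RestrictedFormula.

Variables (R : realType) (F : fieldType) (V : finType).
Variables (sigma : V -> {mpoly F[#|V|]}) (phi : V -> V) (al Dom : {set V}).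
Variable side : pred V.
Implicit Types (p q : {mpoly F[#|V|]}) (U : {set V}).
Hypothesis phi_inj : {in Dom :&: al &, injective phi}.
Hypothesis sigma_alive : forall v, v \in Dom -> v \in al -> sigma v = mvar F (phi v).
Hypothesis sigma_dead :
  forall v, v \in Dom -> v \notin al -> exists a, sigma v = a%:MP.

Local Notation subst f := (substitute sigma (computed f)).

(** The restriction is abstract: on [Dom], [sigma] renames the alive variables by [phi] and makes
    the others constant; [side] tells which alive variables index the rows of the coefficient
    matrix. *)
Definition Y_side (U : {set V}) : {set V} := phi @: [set v in U :&: al | side v].
Definition Z_side (U : {set V}) : {set V} := phi @: [set v in U :&: al | ~~ side v].

Lemma side_disjoint (P P' : pred V) (U U' : {set V}) :
  U \subset Dom -> U' \subset Dom ->
  (forall v, v \in U -> v \in U' -> P v -> P' v -> false) ->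
  [disjoint phi @: [set v in U :&: al | P v] & phi @: [set v in U' :&: al | P' v]].
Proof.
move=> /subsetP UD /subsetP UD' PP'; rewrite -setI_eq0; apply/eqP/setP => v.
rewrite in_setI in_set0; apply/negP => /andP[/imsetP[x]].
rewrite !inE => /andP[/andP[xU xal] xP] -> /imsetP[y].
rewrite !inE => /andP[/andP[yU yal] yP] /phi_inj xy.
have {}xy : x = y by apply: xy; rewrite in_setI ?(UD _ xU) ?(UD' _ yU).
by subst y; exact: notF (PP' x xU yU xP yP).
Qed.

Lemma Y_Z_disjoint (U : {set V}) : U \subset Dom -> [disjoint Y_side U & Z_side U].
Proof. by move=> UD; apply: side_disjoint => // v _ _ /= ->. Qed.

Lemma card_sides (U : {set V}) : U \subset Dom -> (#|Y_side U| + #|Z_side U|)%N = #|U :&: al|.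
Proof.
move=> /subsetP UD; have inj (P : pred V) : {in [set v in U :&: al | P v] &, injective phi}.
  move=> x y; rewrite !inE => /andP[/andP[xU xal] _] /andP[/andP[yU yal] _].
  by apply: phi_inj; rewrite in_setI ?xal ?yal UD.
rewrite /Y_side /Z_side !card_in_imset; [|exact: inj|exact: inj].
rewrite -(cardsID [set v | side v] (U :&: al)); congr (_ + _)%N.
  by apply: eq_card => v; rewrite !inE.
by apply: eq_card => v; rewrite !inE andbC.
Qed.

Definition rel U p : R := relrk R (Y_side U) (Z_side U) p.
Definition uses_sides U p : Prop := uses (Y_side U :|: Z_side U) p.

Lemma rel_le_parity (U : {set V}) p : U \subset Dom -> rel U p <= parity_bound R al U.
Proof. by move=> UD; rewrite /parity_bound -card_sides//; apply: relrk_le_parity. Qed.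

Lemma subst_sum A s :
  subst (Sum A s) = \sum_(c <- s) c.1 *: subst c.2.
Proof.
rewrite /= /substitute big_map raddf_sum /=; apply: eq_bigr => c _.
by rewrite comp_mpolyZ.
Qed.

Lemma subst_prod A t : subst (Prod A t) = \prod_(g <- t) subst g.
Proof. by rewrite /= /substitute big_map rmorph_prod. Qed.

Lemma subst_const A a : subst (Const A a) = a%:MP.
Proof. by rewrite /= /substitute comp_mpolyC. Qed.

Lemma subst_input A v : subst (Input F A v) = sigma v.
Proof.
by rewrite /= /substitute /mvar comp_mpolyXU -tnth_nth tnth_mktuple enum_rankK.
Qed.

Lemma phi_sides U v : v \in U -> v \in al -> phi v \in Y_side U :|: Z_side U.
Proof.
move=> vU val_; rewrite in_setU; have [sv|sv] := boolP (side v); apply/orP.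
  by left; apply: imset_f; rewrite !inE vU val_.
by right; apply: imset_f; rewrite !inE vU val_.
Qed.

Lemma imset_sideU (P : pred V) U U' :
  phi @: [set v in (U :|: U') :&: al | P v]
  = phi @: [set v in U :&: al | P v] :|: phi @: [set v in U' :&: al | P v].
Proof.
rewrite -imsetU; have -> // : [set v in (U :|: U') :&: al | P v]
    = [set v in U :&: al | P v] :|: [set v in U' :&: al | P v].
by apply/setP => v; rewrite !inE !andb_orl.
Qed.

Lemma Y_sideU U U' : Y_side (U :|: U') = Y_side U :|: Y_side U'.
Proof. exact: imset_sideU. Qed.

Lemma Z_sideU U U' : Z_side (U :|: U') = Z_side U :|: Z_side U'.
Proof. exact: imset_sideU. Qed.

Lemma rel_mul U U' p q : U \subset Dom -> U' \subset Dom -> [disjoint U & U'] ->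
  uses_sides U p -> uses_sides U' q ->
  uses_sides (U :|: U') (p * q) /\ rel (U :|: U') (p * q) <= rel U p * rel U' q.
Proof.
move=> UD U'D UU' pU qU'.
have dis (P P' : pred V) :
    [disjoint phi @: [set v in U :&: al | P v] & phi @: [set v in U' :&: al | P' v]].
  by apply: side_disjoint => // v vU; rewrite (disjointFr UU').
split.
  by rewrite /uses_sides Y_sideU Z_sideU setUACA; apply: uses_mul.
rewrite /rel Y_sideU Z_sideU; apply: relrk_mul => //; [exact: dis|exact: dis|].
have dis0 P P' := disjoint_setI0 (dis P P'); pose Z v := ~~ side v.
rewrite -setI_eq0 setIUl !setIUr.
by rewrite (dis0 side side) (dis0 side Z) (dis0 Z side) (dis0 Z Z) !setU0.
Qed.

Lemma input_gate f : is_input f -> Supp f \subset Vars f -> Vars f \subset Dom ->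
  uses_sides (Vars f) (subst f) /\ affine (subst f).
Proof.
case: f => [A a|A v|//|//] _; rewrite ?subst_const ?subst_input /= => sA AD.
  by split; [exact: usesC|exact: affineC].
have vA : v \in A by rewrite -sub1set.
have vD := subsetP AD v vA.
have [va|vna] := boolP (v \in al).
  rewrite sigma_alive//; split; last exact: affine_mvar.
  by apply: uses_mvar; apply: phi_sides.
have [a ->] := sigma_dead vD vna; by split; [exact: usesC|exact: affineC].
Qed.

Lemma linear_gate f : SigmaPiSigma 0 f -> variable_labelled f -> Vars f \subset Dom ->
  uses_sides (Vars f) (subst f) /\ rel (Vars f) (subst f) <= rank_bound R 0 al f.
Proof.
case: f => // A s; rewrite subst_sum /= => s_in /andP[_ /andP[s_vars s_vl]] AD.
suff [? p_aff] : uses_sides A (\sum_(c <- s) c.1 *: subst c.2)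
    /\ affine (\sum_(c <- s) c.1 *: subst c.2).
  split=> //; rewrite /rel -card_sides//.
  by apply: relrk_affine p_aff; exact: Y_Z_disjoint.
elim: s s_in s_vars s_vl => [|c s IH] /=.
  by move=> _ _ _; rewrite big_nil; split; [exact: uses0|exact: affine0].
move=> /andP[c_in s_in] /andP[/eqP cA s_vars] /andP[c_vl s_vl].
have [IH1 IH2] := IH s_in s_vars s_vl; rewrite big_cons.
have c_supp : Supp c.2 \subset Vars c.2 by case: (c.2) c_vl => [? ?|? ?|? ?|? ?] /= /andP[].
have [|h1 h2] := input_gate c_in c_supp; first by rewrite cA.
rewrite cA in h1; split; first by apply: usesD => //; apply: usesZ.
by apply: affineD => //; apply: affineZ.
Qed.

Definition gate_bound D f : Prop := uses_sides (Vars f) (subst f)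
  /\ rel (Vars f) (subst f) <= rank_bound R D al f.

Lemma product_gate_bound D A (t : seq (formula F V)) :
  (forall g, SigmaPiSigma D g -> variable_labelled g -> Vars g \subset Dom ->
     gate_bound D g) ->
  all (@SigmaPiSigma F V D) t -> variable_labelled (Prod A t) -> A \subset Dom ->
  uses_sides A (subst (Prod A t))
  /\ rel A (subst (Prod A t)) <= \prod_(g <- t) factor_bound R D al g.
Proof.
rewrite subst_prod => IHD t_depth /= /andP[_ /and3P[t_dis /eqP <- t_vl]].
elim: t t_depth t_dis t_vl => [|g t IH] /= t_depth t_dis t_vl.
  (* The empty product is 1 and its label is empty; the parity bound on its relative rank is at most
     1. *)
  rewrite !big_nil => _; split; first by rewrite /uses_sides -mpolyC1; exact: usesC.
  by apply: (le_trans (rel_le_parity _ (sub0set _))); exact: parity_bound_le1.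
move: t_depth t_dis t_vl => /andP[g_depth t_depth] /andP[g_dis t_dis] /andP[g_vl t_vl].
rewrite !big_cons subUset => /andP[gD tD].
have [g_uses g_rel] := IHD g g_depth g_vl gD.
have [t_uses t_rel] := IH t_depth t_dis t_vl tD.
have dis : [disjoint Vars g & \bigcup_(B <- [seq Vars h | h <- t]) B].
  elim: (t) g_dis => [|h t' IHt] /=; first by rewrite big_nil -setI_eq0 setI0.
  move=> /andP[gh /IHt gt]; rewrite big_cons -setI_eq0 setIUr.
  by rewrite (disjoint_setI0 gh) (disjoint_setI0 gt) setU0.
have [uses_gt rel_gt] := rel_mul gD tD dis g_uses t_uses.
split=> //; apply: (le_trans rel_gt); apply: ler_pM => //; try exact: relrk_ge0.
by rewrite le_min rel_le_parity.
Qed.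

(** Follows the clauses of [rank_bound]: rank at most 2 at the bottom gates, [rel_mul] at the
    products, subadditivity at the sums. *)
Lemma formula_bound D f : SigmaPiSigma D f -> variable_labelled f ->
  Vars f \subset Dom -> gate_bound D f.
Proof.
elim: D f => [|D IHD]; first exact: linear_gate.
case=> // A s s_depth /andP[_ /andP[s_vars s_vl]] /= AD; rewrite /gate_bound subst_sum /=.
elim: s s_depth s_vars s_vl => [|c s IH] /=.
  by move=> _ _ _; rewrite !big_nil /rel relrk0; split=> //; exact: uses0.
move=> /andP[c_depth s_depth] /andP[/eqP cA s_vars] /andP[c_vl s_vl].
have [s_uses s_rel] := IH s_depth s_vars s_vl; rewrite !big_cons.
case: (c.2) c_depth cA c_vl => // A' t t_depth /= A'A t_vl.
rewrite A'A in t_vl *; have [c_uses c_rel] := product_gate_bound IHD t_depth t_vl AD.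
split; first by apply: usesD => //; apply: usesZ.
apply: (le_trans (relrkD _ _ _ _ _)); apply: lerD => //.
exact: le_trans (relrkZ _ _ _ _ _) c_rel.
Qed.

End RestrictedFormula.

(** * Restrictions of the segments *)

Section Clones.

Variable m : nat.

Lemma clone_x_inj D d (w w' : d.-tuple ('I_m * 'I_2)) (x x' : xvar m D) :
  clone_x w x = clone_x w' x' -> w = w' /\ x = x'.
Proof.
elim: d w w' => [|d IH] w w' /=; first by rewrite (tuple0 w) (tuple0 w').
case=> w1 w2 /IH[/(congr1 val) /= wE ->]; split=> //; apply: val_inj.
rewrite (tuple_eta w) (tuple_eta w') /= wE; congr (_ :: _).
by rewrite (surjective_pairing (thead w)) w1 w2 -surjective_pairing.
Qed.

Lemma clone_y_inj D d (w w' : d.-tuple ('I_m * 'I_2)) (y y' : yvar m D) :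
  clone_y w y = clone_y w' y' -> w = w' /\ y = y'.
Proof.
elim: d w w' => [|d IH] w w' /=; first by rewrite (tuple0 w) (tuple0 w').
case=> w1 w2 /IH[/(congr1 val) /= wE ->]; split=> //; apply: val_inj.
rewrite (tuple_eta w) (tuple_eta w') /= wE; congr (_ :: _).
by rewrite (surjective_pairing (thead w)) w1 w2 -surjective_pairing.
Qed.

Lemma seg_x_inj D d (a a' : segment m d) (x x' : xseg m D) :
  seg_x a x = seg_x a' x' -> a = a' /\ x = x'.
Proof. by case: a a' => [w i] [w' i'] /clone_x_inj /= [-> [-> ->]]. Qed.

Lemma seg_y_inj D d (a a' : segment m d) (y y' : yseg m D) :
  seg_y a y = seg_y a' y' -> a = a' /\ y = y'.
Proof. by case: a a' => [w i] [w' i'] /clone_y_inj /= [-> [-> ->]]. Qed.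

Lemma card_Xsegment D d (a : segment m d) :
  #|Xsegment D a| = (2 * #|xvar m D|)%N.
Proof.
by rewrite card_imset => [|x x' /seg_x_inj[]//]; rewrite card_prod card_ord.
Qed.

Variables (D d M : nat) (a : 'I_M -> segment m d).
Hypothesis a_inj : injective a.

Lemma rho_segments_seg c i (x : xseg m D) :
  rho_segments a c (seg_x (a i) x)
  = map_target (@seg_y m D d (a i)) (@seg_y m D d (a i)) (algA (@rho m D) (c i) x).
Proof.
rewrite /rho_segments; case: pickP => [[i' x'] /= /eqP/seg_x_inj[/a_inj -> ->] //|].
by move=> /(_ (i, x)) /=; rewrite eqxx.
Qed.

Lemma rho_segments_inj (c : {ffun 'I_M -> seg_coins m D}) i i' (x x' : xseg m D) :
  x \in survivors (c i) ->
  rho_segments a c (seg_x (a i) x) = rho_segments a c (seg_x (a i') x') ->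
  i = i' /\ x = x'.
Proof.
rewrite !rho_segments_seg inE => bx E.
have ii' : i = i'.
  by move: bx E; case: (algA _ (c i) x) (algA _ (c i') x') => [y|z|b] [y'|z'|b'] //=
    _ [] /seg_y_inj[/a_inj].
subst i'; split=> //; apply: (algA_inj (@rho_inj m D) bx).
by apply: map_target_inj bx E => y y' /seg_y_inj[].
Qed.

Variables (R : realType) (F : fieldType) (W : finType).

Local Notation L := (d + D.+1)%N.
Local Notation VX := (@vX m L W).
Local Notation VY := (@vY m L W).
Local Notation VZ := (@vZ m L W).

Variable X'_ : 'I_M -> {set xvar m L}.
Hypothesis X'_sub : forall i, X'_ i \subset Xsegment D (a i).
Variables Y' Z' : {set var m L W}.

Local Notation X := (\bigcup_(i < M) Xsegment D (a i)).
Local Notation Y := (\bigcup_(i < M) Ysegment D (a i)).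
Local Notation X' := (\bigcup_(i < M) X'_ i).
Local Notation XYZ := (VX @: X :|: VY @: Y :|: VZ @: Y).

Hypothesis YZ_disjoint : [disjoint Y' & Z'].
Hypothesis Y_off : [disjoint Y' & XYZ].
Hypothesis Z_off : [disjoint Z' & XYZ].

Definition segment_var (i : 'I_M) (x : xseg m D) : var m L W := VX (seg_x (a i) x).

Lemma segment_var_inj : embeds_segments [set: 'I_M] segment_var.
Proof. by move=> i i' x x' _ _ [] /seg_x_inj[/a_inj]. Qed.

Lemma segment_in_X i (x : xseg m D) : seg_x (a i) x \in X.
Proof. by apply/bigcupP; exists i => //; apply: imset_f. Qed.

Lemma segment_in_Y i (y : yseg m D) : seg_y (a i) y \in Y.
Proof. by apply/bigcupP; exists i => //; apply: imset_f. Qed.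

Lemma fixed_notin_XYZ v : v \in Y' :|: Z' -> v \notin XYZ.
Proof.
by rewrite in_setU => /orP[vY|vZ];
  [rewrite (disjointFr Y_off vY)|rewrite (disjointFr Z_off vZ)].
Qed.

Lemma segment_var_off : avoids_segments [set: 'I_M] segment_var (Y' :|: Z').
Proof.
move=> i x _; apply/negP => /fixed_notin_XYZ; rewrite !in_setU !negb_or.
by rewrite /segment_var imset_f ?segment_in_X.
Qed.

Section OneRestriction.

Variable c : {ffun 'I_M -> seg_coins m D}.

Let r := @rho_segments m D d M a c.
Let al : {set var m L W} := alive [set: 'I_M] segment_var (Y' :|: Z') c.
Let Dom : {set var m L W} := VX @: X' :|: Y' :|: Z'.

(** Variables of [X^(L)] outside the given segments may belong to [Y'] or [Z']; the test [x \in X]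
    leaves them in place. *)
Let image_var (v : var m L W) : var m L W :=
  match v with
  | inl (inl x) => if x \in X then
      match r x with ToY y => VY y | ToZ z => VZ z | ToBit _ => v end else v
  | _ => v
  end.

Let on_Y_side (v : var m L W) : bool :=
  match v with
  | inl (inl x) => if x \in X then if r x is ToY _ then true else false else v \in Y'
  | _ => v \in Y'
  end.

Let sigma (v : var m L W) : {mpoly F[#|var m L W|]} :=
  match v with
  | inl (inl x) =>
      if x \in X' then
        match r x with
        | ToY y => mvar F (VY y)
        | ToZ z => mvar F (VZ z)
        | ToBit b => b%:R
        end
      else mvar F v
  | _ => mvar F v
  end.

Lemma X'_segment x : x \in X' -> exists i x0, x = seg_x (a i) x0.
Proof.
by case/bigcupP => i _ /(subsetP (X'_sub i))/imsetP[x0 _ ->]; exists i, x0.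
Qed.

Lemma X'_in_X x : x \in X' -> x \in X.
Proof. by case/X'_segment => i [x0 ->]; exact: segment_in_X. Qed.

Lemma alive_segment i x0 : (segment_var i x0 \in al) = (x0 \in survivors (c i)).
Proof.
rewrite in_setU (negPf (segment_var_off x0 (in_setT i))) /=.
apply/bigcupP/idP => [[i' _ /imsetP[x' xs]]|xs]; last first.
  by exists i; [exact: in_setT|exact: imset_f].
by case/(segment_var_inj (in_setT _) (in_setT _)) => -> ->.
Qed.

Lemma survivors_bit i x0 :
  (x0 \in survivors (c i)) = ~~ is_bit (r (seg_x (a i) x0)).
Proof. by rewrite /r rho_segments_seg is_bit_map in_set. Qed.

Lemma fixed_vX x : VX x \in Y' :|: Z' -> x \notin X.
Proof.
by move/fixed_notin_XYZ; apply: contraNN => xX; rewrite !in_setU imset_f.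
Qed.

Lemma fixed_image v : v \in Y' :|: Z' -> image_var v = v.
Proof. by case: v => [[x|w]|[y|z]] // /fixed_vX /negPf /= ->. Qed.

Lemma fixed_sigma v : v \in Y' :|: Z' -> sigma v = mvar F v.
Proof.
case: v => [[x|w]|[y|z]] // /fixed_vX xX /=.
by rewrite (negPf (contraNN (@X'_in_X x) xX)).
Qed.

Lemma fixed_side v : v \in Y' :|: Z' -> on_Y_side v = (v \in Y').
Proof. by case: v => [[x|w]|[y|z]] // /fixed_vX /negPf /= ->. Qed.

Lemma Dom_cases v : v \in Dom -> v \in al -> v \in Y' :|: Z' \/
  exists i x0, [/\ v = segment_var i x0, seg_x (a i) x0 \in X' & x0 \in survivors (c i)].
Proof.
rewrite /Dom -setUA in_setU => /orP[/imsetP[x xX' ->]|->]; last by left.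
have [i [x0 xE]] := X'_segment xX'; rewrite xE in xX' *.
by rewrite (alive_segment i x0); right; exists i, x0.
Qed.

Lemma image_in_YZ i x0 : x0 \in survivors (c i) -> image_var (segment_var i x0) \in XYZ.
Proof.
rewrite /= segment_in_X /r rho_segments_seg inE.
by case: (algA _ _ _) => [y|z|b] //= _; rewrite !in_setU imset_f ?segment_in_Y ?orbT.
Qed.

(** Variables of [Y'] and [Z'] stay fixed and avoid [XYZ], where the images of the survivors lie;
    two survivors are separated by [rho_segments_inj]. *)
Lemma image_var_inj : {in Dom :&: al &, injective image_var}.
Proof.
move=> v v' /setIP[vD va] /setIP[v'D v'a].
case: (Dom_cases vD va) => [vF|[i [x0 [-> xX' xs]]]];
  case: (Dom_cases v'D v'a) => [v'F|[i' [x0' [-> x'X' x's]]]].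
- by rewrite !fixed_image.
- by rewrite (fixed_image vF) => vE; have := fixed_notin_XYZ vF; rewrite vE image_in_YZ.
- by rewrite (fixed_image v'F) => v'E; have := fixed_notin_XYZ v'F; rewrite -v'E image_in_YZ.
rewrite /= !segment_in_X => E.
suff [-> ->] : i = i' /\ x0 = x0' by [].
apply: (rho_segments_inj xs); move: E xs x's; rewrite -/r !survivors_bit.
case: (r _) => [y|z|b]; case: (r _) => [y'|z'|b'] //=.
  by move=> [->].
by move=> [->].
Qed.

Lemma sigma_alive v : v \in Dom -> v \in al -> sigma v = mvar F (image_var v).
Proof.
move=> vD va; case: (Dom_cases vD va) => [vF|[i [x0 [-> xX' xs]]]].
  by rewrite fixed_sigma// fixed_image.
rewrite /= xX' segment_in_X; move: xs; rewrite survivors_bit.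
by case: (r _).
Qed.

Lemma sigma_dead v : v \in Dom -> v \notin al -> exists b, sigma v = b%:MP.
Proof.
move=> vD va; have : v \in VX @: X'.
  move: vD; rewrite /Dom -setUA in_setU => /orP[//|vF].
  by rewrite /al /alive in_setU vF in va.
case/imsetP => x xX' vE; have [i [x0 xE]] := X'_segment xX'.
rewrite {v}vE {x}xE in vD va xX' *; move: va; rewrite (alive_segment i x0) survivors_bit negbK.
rewrite /= xX'; case: (r _) => [//|//|b] _; exists b%:R.
by rewrite mpolyC_nat.
Qed.

Lemma Y_side_Dom :
  Y_side image_var al on_Y_side Dom = Y' :|: VY @: image_Y r X' Y.
Proof.
apply/setP => v; apply/imsetP/setUP.
  case=> u; rewrite !inE -!in_setU => /andP[/andP[uD ua] us] ->.
  case: (Dom_cases uD ua) us => [uF|[i [x0 [-> xX' xs]]]].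
    by rewrite fixed_side// fixed_image//; left.
  rewrite /= segment_in_X; case E : (r _) => [y|z|b] // _; right.
  apply: imset_f; rewrite inE; apply/andP; split.
    move: E; rewrite /r rho_segments_seg; case: (algA _ _ _) => //= y' [<-].
    exact: segment_in_Y.
  by apply/existsP; exists (seg_x (a i) x0); rewrite xX' E eqxx.
case=> [vY|/imsetP[y]].
  have vF : v \in Y' :|: Z' by rewrite in_setU vY.
  exists v; last by rewrite fixed_image.
  rewrite in_set in_setI fixed_side// vY andbT; apply/andP; split.
    by rewrite /Dom -setUA in_setU vF orbT.
  by rewrite /al /alive in_setU vF.
rewrite inE => /andP[yY /existsP[x /andP[xX']]] ry ->.
have [i [x0 xE]] := X'_segment xX'; subst x.
exists (segment_var i x0); last first.
  by rewrite /= segment_in_X; case: (r _) ry => // y' /eqP ->.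
rewrite in_set in_setI /= segment_in_X (alive_segment i x0) survivors_bit.
by rewrite /Dom !in_setU /segment_var imset_f//=; case: (r _) ry.
Qed.

Lemma Z_side_Dom :
  Z_side image_var al on_Y_side Dom = Z' :|: VZ @: image_Z r X' Y.
Proof.
apply/setP => v; apply/imsetP/setUP.
  case=> u; rewrite !inE -!in_setU => /andP[/andP[uD ua] us] ->.
  case: (Dom_cases uD ua) us => [uF|[i [x0 [-> xX' xs]]]].
    rewrite fixed_side// fixed_image// => uY; left.
    by move: uF; rewrite in_setU (negPf uY).
  move: xs; rewrite survivors_bit.
  rewrite /= segment_in_X; case E : (r _) => [y|z|b] // _ _; right.
  apply: imset_f; rewrite inE; apply/andP; split.
    move: E; rewrite /r rho_segments_seg; case: (algA _ _ _) => //= y' [<-].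
    exact: segment_in_Y.
  by apply/existsP; exists (seg_x (a i) x0); rewrite xX' E eqxx.
case=> [vZ|/imsetP[z]].
  have vF : v \in Y' :|: Z' by rewrite in_setU vZ orbT.
  exists v; last by rewrite fixed_image.
  rewrite in_set in_setI fixed_side// (disjointFl YZ_disjoint vZ) andbT.
  apply/andP; split; first by rewrite /Dom -setUA in_setU vF orbT.
  by rewrite /al /alive in_setU vF.
rewrite inE => /andP[zY /existsP[x /andP[xX']]] rz ->.
have [i [x0 xE]] := X'_segment xX'; subst x.
exists (segment_var i x0); last first.
  by rewrite /= segment_in_X; case: (r _) rz => // z' /eqP ->.
rewrite in_set in_setI /= segment_in_X (alive_segment i x0) survivors_bit.
by rewrite /Dom !in_setU /segment_var imset_f//=; case: (r _) rz.
Qed.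

Lemma restricted_relrk (D0 : nat) (Phi : formula F (var m L W)) :
  SigmaPiSigma D0 Phi -> variable_labelled Phi -> Vars Phi = VX @: X' :|: Y' :|: Z' ->
  relrk R (Y' :|: VY @: image_Y r X' Y) (Z' :|: VZ @: image_Z r X' Y)
     (restrict X' r (computed Phi))
  <= rank_bound R D0 (alive [set: 'I_M] segment_var (Y' :|: Z') c) Phi.
Proof.
move=> depth vl VarsE.
have VD : Vars Phi \subset Dom by rewrite VarsE.
have [_] := formula_bound R on_Y_side image_var_inj sigma_alive sigma_dead depth vl VD.
by rewrite /rel VarsE -/Dom Y_side_Dom Z_side_Dom.
Qed.

End OneRestriction.

End Clones.

(** * Parameters compared as powers of [u] *)

Section Constants.

Variables (R : realType) (u : R).
Hypothesis u_ge2 : 2 <= u.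

Lemma const_le_pow (n k : nat) : (n <= 2 ^ k)%N -> n%:R <= u ^+ k.
Proof.
rewrite -(ler_nat R) => /le_trans; apply; rewrite natrX.
by apply: lerXn2r; rewrite ?nnegrE// (le_trans _ u_ge2).
Qed.

Lemma pow_u_le (j k : nat) : (j <= k)%N -> u ^+ j <= u ^+ k.
Proof. by move=> jk; apply: ler_weXn2l => //; move: u_ge2; lra. Qed.

Lemma u_ge0 : 0 <= u. Proof. by move: u_ge2; lra. Qed.

Variables T L Q : nat.
Hypothesis T_le : T%:R <= 4 * u + 1.
Hypothesis L_def : L = (768 * (2 * T + 1))%N.
Hypothesis Q_def : Q = (2 * L ^ 2)%N.

(** [2 * T + 1 <= 11 * u <= u ^+ 5] and [768 <= u ^+ 10] give [L <= u ^+ 15]. *)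
Lemma Q_le_pow : Q%:R <= u ^+ 31.
Proof.
have h : (2 * T + 1)%:R <= u ^+ 5.
  have := @const_le_pow 11 4 isT; rewrite natrD natrM [u ^+ 5]exprS.
  by move: T_le u_ge2; set v := u ^+ 4; nra.
have L_le : L%:R <= u ^+ 15.
  rewrite L_def natrM -[15%N]/(10 + 5)%N exprD ler_pM//.
  exact: const_le_pow.
rewrite Q_def natrM natrX [u ^+ 31]exprS ler_pM ?exprn_ge0//.
by rewrite -[30%N]/(15 * 2)%N exprM lerXn2r ?nnegrE ?exprn_ge0 ?u_ge0.
Qed.

Lemma Q_gt0_param : 0 < Q%:R :> R.
Proof. by rewrite ltr0n Q_def L_def !(muln_gt0, expn_gt0) addn1. Qed.

(** [4 * Q <= u ^+ 33] leaves [u ^+ 167] of [mr], far above the linear term in [T]. The left side is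
    the room needed for the bound on [B]. *)
Lemma exponent_le (mr : R) : u ^+ 200 = mr ->
  201 * u ^+ 2 <= mr / (4 * Q%:R) - (2 * T + 2)%:R.
Proof.
move=> <-; have Q0 := Q_gt0_param; have u0 := u_ge0.
have h1 : u ^+ 167 <= u ^+ 200 / (4 * Q%:R).
  rewrite ler_pdivlMr ?mulr_gt0// -[200%N]/(167 + (2 + 31))%N [u ^+ (167 + _)]exprD.
  rewrite ler_wpM2l ?exprn_ge0// [u ^+ (2 + _)]exprD ler_pM//; last exact: Q_le_pow.
  by rewrite (const_le_pow (n := 4)).
have h2 : u ^+ 10 <= u ^+ 167 by exact: pow_u_le.
have h3 : 256 * u ^+ 2 <= u ^+ 10.
  rewrite -[10%N]/(8 + 2)%N exprD ler_wpM2r ?exprn_ge0//; exact: const_le_pow.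
have h4 : u * 2 <= u ^+ 2 by rewrite expr2 ler_wpM2l.
apply: le_trans (lerB (le_trans h2 h1) (lexx _)); rewrite natrD natrM.
move: h3 h4 T_le u_ge2; set v := u ^+ 2; set v' := u ^+ 10; lra.
Qed.

End Constants.

(** * Choice of the parameters and conclusion *)

Lemma half_pow_le_expR (R : realType) (n : nat) (x : R) :
  2 * x <= n%:R -> (1 / 2) ^+ n <= expR (- x).
Proof.
move=> xn; apply: (@le_trans _ _ (expR (n%:R * (- (1 / 2))))).
  rewrite expRM_natl; apply: lerXn2r; rewrite ?nnegrE ?expR_ge0 ?divr_ge0//.
  by have := expR_ge1Dx (- (1 / 2) : R); lra.
by rewrite ler_expR; lra.
Qed.

Theorem theorem4p4 (R : realType) :
  exists m0 : nat,
  forall (F : fieldType) (W : finType) (m k M D d : nat)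
         (Delta := D.+1) (Delta' := (d + Delta)%N),
  (m0 <= m)%N ->
  k%:R = m%:R `^ (5 / 100) :> R ->
  m%:R / 10 <= M%:R :> R ->
  Delta'%:R <= m%:R `^ (1 / 1000) :> R ->
  forall eps : R,
  0 < eps ->
  1 / M%:R `^ (25 / 100) <= eps ->
  forall a : 'I_M -> segment m d,
  injective a ->
  let X := \bigcup_(i < M) Xsegment D (a i) in
  let Y := \bigcup_(i < M) Ysegment D (a i) in
  let Z := \bigcup_(i < M) Ysegment D (a i) in
  forall X'_ : 'I_M -> {set xvar m Delta'},
  (forall i, X'_ i \subset Xsegment D (a i)) ->
  (forall i, eps * #|Xsegment D (a i)|%:R <= #|X'_ i|%:R) ->
  let X' := \bigcup_(i < M) X'_ i in
  forall Y' Z' : {set var m Delta' W},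
  let XYZ := (@vX m Delta' W) @: X :|: (@vY m Delta' W) @: Y
             :|: (@vZ m Delta' W) @: Z in
  [disjoint Y' & Z'] ->
  [disjoint Y' & XYZ] ->
  [disjoint Z' & XYZ] ->
  forall Phi : formula F (var m Delta' W),
  SigmaPiSigma Delta Phi ->
  syntactically_multilinear Phi ->
  variable_labelled Phi ->
  Vars Phi = (@vX m Delta' W) @: X' :|: Y' :|: Z' ->
  (fsize Phi)%:R <= expR (k%:R `^ (1 / 10) / Delta%:R ^+ 2) :> R ->
  prob R (fun c : {ffun 'I_M -> seg_coins m D} =>
    let r := rho_segments a c in
    let Yt := (@vY m Delta' W) @: image_Y r X' Y in
    let Zt := (@vZ m Delta' W) @: image_Z r X' Z in
    expR (- (k%:R `^ (1 / 10) / Delta%:R))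
      <= relrk R (Y' :|: Yt) (Z' :|: Zt) (restrict X' r (computed Phi)))
  <= Delta%:R * expR (- (k%:R `^ (1 / 10) / Delta%:R)).
Proof.
(* [m >= 2 ^+ 200] makes [u = m ^ (1 / 200)], which equals [k ^ 0.1], at least 2. *)
have [m0 m0_ge] : exists m0 : nat, 2 ^+ 200 <= m0%:R :> R.
  by exists (Num.trunc (2 ^+ 200 : R)).+1; apply: ltW; exact: truncnS_gt.
exists m0 => F W m k M D d Delta Delta' m0_le k_def M_ge Delta'_le eps eps_gt0 eps_ge.
move=> a a_inj X Y Z X'_ X'_sub X'_ge X' Y' Z' XYZ YZ_dis Y_off Z_off Phi depth _ vl
  VarsE size_le.
have m_ge : 2 ^+ 200 <= m%:R :> R by apply: (le_trans m0_ge); rewrite ler_nat.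
pose u : R := m%:R `^ (1 / 200).
have m_gt0R : 0 < m%:R :> R by apply: lt_le_trans m_ge; rewrite exprn_gt0.
have m_gt0 : (0 < m)%N by rewrite ltr0n in m_gt0R.
have u_ge0 : 0 <= u by exact: powR_ge0.
have u_pow : u ^+ 200 = m%:R.
  rewrite /u -powR_mulrn ?powR_ge0// -powRrM.
  have -> : 1 / 200 * 200%:R = 1 :> R by field.
  by rewrite powRr1// ltW.
have u_ge2 : 2 <= u.
  by rewrite -(@ler_pXn2r _ 200) ?nnegrE// u_pow.
have K_def : k%:R `^ (1 / 10) = u :> R.
  by rewrite k_def -powRrM /u; congr (_ `^ _); field.
rewrite !K_def in size_le *.
have m_ge1 : 1 <= m%:R :> R by rewrite ler1n.
have Delta'_le_u : Delta'%:R <= u.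
  by apply: (le_trans Delta'_le); rewrite /u ler_powR//; lra.
(* [T > 4 * u] gives [eta <= exp (- 2 * u)]; this absorbs [s ^ Delta <= exp (u / Delta)] and still
   leaves [exp (- u / Delta)]. *)
pose T := (Num.trunc (4 * u)).+1.
have /andP[trunc_le trunc_gt] : (Num.trunc (4 * u))%:R <= 4 * u < T%:R.
  by apply: truncn_itv; rewrite mulr_ge0.
have T_le : T%:R <= 4 * u + 1 by rewrite /T -natr1; lra.
pose L := (768 * (2 * T + 1))%N; pose Q := (2 * L ^ 2)%N.
(* There are at most [(2 * m) ^ d * m] segments, hence at most [B] subsegments at any lower
   level. *)
pose B := ((m * 2) ^ Delta')%N; pose s := fsize Phi.
have B_gt0 : (0 < B)%N by rewrite expn_gt0 muln_gt0 m_gt0.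
have B_le : B%:R <= expR (m%:R / (4 * Q%:R) - (2 * T + 2)%:R) :> R.
  have two_m : (m * 2)%:R <= expR (1 + 200 * u) :> R.
    rewrite natrM -u_pow mulrC expRD; apply: ler_pM; rewrite ?exprn_ge0//.
      by apply: le_trans (expR_ge1Dx _); lra.
    rewrite -[200 * u]/(200%:R * u) expRM_natl.
    by apply: lerXn2r; rewrite ?nnegrE ?expR_ge0//; have := expR_ge1Dx u; lra.
  rewrite /B natrX; apply: (@le_trans _ _ (expR (1 + 200 * u) ^+ Delta')).
    by apply: lerXn2r; rewrite ?nnegrE ?expR_ge0.
  rewrite -expRM_natl ler_expR.
  apply: le_trans (exponent_le u_ge2 T_le erefl erefl u_pow).
  apply: (@le_trans _ _ (u * (1 + 200 * u))); last by rewrite expr2; nra.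
  by rewrite ler_wpM2r//; lra.
have M_card : (#|'I_M| * m ^ D <= B)%N.
  have M_le : (M <= (m * 2) ^ d * m)%N.
    by have := leq_card a a_inj; rewrite card_prod card_tuple card_prod !card_ord.
  rewrite card_ord /B /Delta' /Delta expnD; apply: (leq_trans (leq_mul M_le (leqnn _))).
  by rewrite -mulnA -expnS leq_mul// leq_exp2r// leq_pmulr.
have mass : (Q * #|xvar m D| <=
    \sum_i #|trace [set: 'I_M] (segment_var a W) (Vars Phi) i|)%N.
  have X'_le i : (#|X'_ i| <= #|trace [set: 'I_M] (segment_var a W) (Vars Phi) i|)%N.
    apply: leq_trans (leq_imset_card (seg_x (a i)) _).
    apply/subset_leq_card/subsetP => x xX'.
    have /imsetP[x0 _ xE] := subsetP (X'_sub i) x xX'; rewrite xE in xX' *.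
    apply: imset_f; rewrite /trace in_setT in_set VarsE !in_setU /segment_var imset_f//.
    by apply/bigcupP; exists i.
  apply: leq_trans (leq_sum _ (fun i _ => X'_le i)); rewrite -(ler_nat R) natr_sum.
  apply: le_trans (ler_sum _ (fun i _ => X'_ge i)).
  under eq_bigr do rewrite card_Xsegment.
  rewrite sumr_const card_ord -[leRHS]mulr_natr [leRHS]mulrC.
  rewrite [leLHS]natrM [(2 * #|_|)%:R]natrM !mulrA.
  (* With [v] the fourth root of [M] and [eps * v >= 1], the density [M * eps] is at least [v ^+ 3].
     Moreover [M >= m / 10 >= u ^+ 196] gives [v >= u ^+ 49 >= Q]. *)
  rewrite ler_wpM2r//; pose v : R := M%:R `^ (25 / 100).
  have v_ge0 : 0 <= v by exact: powR_ge0.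
  have v_pow : v ^+ 4 = M%:R.
    rewrite /v -powR_mulrn ?powR_ge0// -powRrM.
    have -> : 25 / 100 * 4%:R = 1 :> R by field.
    by rewrite powRr1.
  have v_ge : u ^+ 49 <= v.
    rewrite -(@ler_pXn2r _ 4) ?nnegrE ?exprn_ge0// v_pow -exprM.
    apply: le_trans M_ge; rewrite -u_pow ler_pdivlMr// -[200%N]/(49 * 4 + 4)%N.
    by rewrite exprD ler_wpM2l ?exprn_ge0//; exact: (@const_le_pow R u u_ge2 10 4).
  have Q_le : Q%:R <= u ^+ 49.
    by apply: le_trans (Q_le_pow u_ge2 T_le erefl erefl) _; exact: pow_u_le.
  have v_gt0 : 0 < v by apply: lt_le_trans v_ge; rewrite exprn_gt0//; lra.
  have v_ge1 : 1 <= v.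
    by apply: le_trans v_ge; rewrite exprn_ege1//; lra.
  have eps_v : 1 <= eps * v by rewrite -ler_pdivrMr.
  rewrite -v_pow; apply: (@le_trans _ _ (v ^+ 3 * (eps * v))); last first.
    have -> : v ^+ 4 * eps * 2 = v ^+ 3 * (eps * v) * 2 by ring.
    by rewrite ler_peMr ?ler1n// mulr_ge0 ?exprn_ge0// mulr_ge0// ltW.
  apply: (le_trans Q_le); apply: (le_trans v_ge).
  apply: (@le_trans _ _ (v ^+ 3)); last by rewrite ler_peMr ?exprn_ge0.
  by rewrite -[leLHS]expr1 ler_weXn2l.
pose eta : R := (1 / 2) ^+ T.
have level_le : (s ^ D.+1)%:R * eta <= expR (- (u / Delta%:R)).
  have Delta_gt0 : 0 < Delta%:R :> R by rewrite ltr0n.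
  have Delta_ge1 : 1 <= Delta%:R :> R by rewrite ler1n.
  have s_le : (s ^ D.+1)%:R <= expR (u / Delta%:R) :> R.
    rewrite natrX; apply: (@le_trans _ _ (expR (u / Delta%:R ^+ 2) ^+ D.+1)).
      by apply: lerXn2r; rewrite ?nnegrE ?expR_ge0.
    rewrite -expRM_natl ler_expR -/Delta.
    by have -> : Delta%:R * (u / Delta%:R ^+ 2) = u / Delta%:R by field; rewrite gt_eqF.
  have eta_le : eta <= expR (- (2 * u)).
    by apply: half_pow_le_expR; have := ltW trunc_gt; lra.
  apply: (le_trans (ler_pM _ _ s_le eta_le)) => //; first by rewrite exprn_ge0 ?divr_ge0.
  have : u / Delta%:R <= u by rewrite ler_pdivrMr// ler_peMr.
  by rewrite -expRD ler_expR; lra.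
have := @depth_claim_holds R F _ m T L Q B s m_gt0 (fsize_gt0 Phi) B_gt0 erefl
  (leqnn _) B_le D _ _ _ (Y' :|: Z') Phi (segment_var_inj a_inj (W := W))
  (segment_var_off Y_off Z_off) depth vl (leqnn _) M_card mass.
move=> claim; apply: (@le_trans _ _ (D.+1%:R * ((s ^ D.+1)%:R * eta))); last first.
  by rewrite ler_wpM2l.
apply: le_trans claim; apply: prob_le => c relrk_ge.
apply: (le_trans level_le); apply: (le_trans relrk_ge).
exact: restricted_relrk.
Qed.
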